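(* (i) $R_{\mathcal{S}^*_{Ne}}(\mathcal{S}^*_{RL})=\dfrac{56}{122-41\sqrt2}$. (ii) $R_{\mathcal{S}^*_{Ne}}(\mathcal{S}^*_{C})=\sqrt2-1$. (iii) $R_{\mathcal{S}^*_{Ne}}(\mathcal{S}^*_{R})=\dfrac{1}{3\sqrt2-3}$. Each radius is sharp, i.e. it is the exact value of the radius.
   Context: $\mathbb{D}=\{|z|<1\}$, $\mathbb{D}_r=\{|z|<r\}$. $\mathcal{A}$ is the class of analytic $f$ on $\mathbb{D}$ with $f(0)=0$, $f'(0)=1$; for $f\in\mathcal{A}$ let $\mathcal{Q}_f(z)=zf'(z)/f(z)$. For analytic $F,G$ on $\mathbb{D}$, $F\prec G$ means $F=G\circ w$ for some analytic $w:\mathbb{D}\to\mathbb{D}$ with $w(0)=0$. For analytic $\varphi$ on $\mathbb{D}$, $\mathcal{S}^*(\varphi)=\{f\in\mathcal{A}:\mathcal{Q}_f\prec\varphi\}$. Let $\varphi_{Ne}(z)=1+z-z^3/3$ (univalent on $\mathbb{D}$), $\Omega_{Ne}=\varphi_{Ne}(\mathbb{D})$, $\mathcal{S}^*_{Ne}=\mathcal{S}^*(\varphi_{Ne})$. For $\mathcal{G}\subset\mathcal{A}$, $R_{\mathcal{S}^*_{Ne}}(\mathcal{G})$ is the largest $\rho\in(0,1]$ such that $\mathcal{Q}_f(\mathbb{D}_\rho)\subseteq\Omega_{Ne}$ for all $f\in\mathcal{G}$ (equivalently $r^{-1}f(rz)\in\mathcal{S}^*_{Ne}$ for all $f\in\mathcal{G}$,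 $0<r\le\rho$). Classes: $\mathcal{S}^*_{RL}=\mathcal{S}^*(\varphi_{RL})$ with $\varphi_{RL}(z)=\sqrt2-(\sqrt2-1)\sqrt{\frac{1-z}{1+2(\sqrt2-1)z}}$ (principal branch); $\mathcal{S}^*_C=\mathcal{S}^*\big(1+\frac43 z+\frac23 z^2\big)$; $\mathcal{S}^*_R=\mathcal{S}^*(\varphi_0)$ with $\varphi_0(z)=1+\frac{z}{k}\cdot\frac{k+z}{k-z}$, $k=\sqrt2+1$. *)

(* Defs.v *)
From Stdlib Require Import Reals Lra ClassicalEpsilon.
Open Scope R_scope.

Definition C : Type := (R * R)%type.
Definition C0 : C := (0, 0).
Definition C1 : C := (1, 0).
Definition RtoC (x : R) : C := (x, 0).
Definition Cadd (a b : C) : C := (fst a + fst b, snd a + snd b).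
Definition Copp (a : C) : C := (- fst a, - snd a).
Definition Csub (a b : C) : C := Cadd a (Copp b).
Definition Cmul (a b : C) : C :=
  (fst a * fst b - snd a * snd b, fst a * snd b + snd a * fst b).
(** inverse, with the explicit convention Cinv 0 = 0 *)
Definition Cinv (a : C) : C :=
  let d := fst a * fst a + snd a * snd a in
  if Req_EM_T d 0 then C0 else (fst a / d, - snd a / d).
Definition Cdiv (a b : C) : C := Cmul a (Cinv b).
Definition Cnorm (a : C) : R := sqrt (fst a * fst a + snd a * snd a).

(** principal branch of the square root (argument in (-pi/2, pi/2]) *)
Definition Csqrt (a : C) : C :=
  let r := Cnorm a in
  (sqrt ((r + fst a) / 2),
   (if Rlt_dec (snd a) 0 then -1 else 1) * sqrt ((r - fst a) / 2)).

Definition Cderiv_at (f : C -> C) (z l : C) : Prop :=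
  forall eps : R, 0 < eps -> exists delta : R, 0 < delta /\
    forall h : C, h <> C0 -> Cnorm h < delta ->
      Cnorm (Csub (Cdiv (Csub (f (Cadd z h)) (f z)) h) l) < eps.

Definition in_disk (r : R) (z : C) : Prop := Cnorm z < r.
Definition in_D (z : C) : Prop := in_disk 1 z.

Definition analytic_on_D (f : C -> C) : Prop :=
  forall z, in_D z -> exists l, Cderiv_at f z l.

(** the derivative (chosen; unique where it exists) *)
Definition Cderiv (f : C -> C) (z : C) : C :=
  epsilon (inhabits C0) (fun l => Cderiv_at f z l).

Definition classA (f : C -> C) : Prop :=
  analytic_on_D f /\ f C0 = C0 /\ Cderiv_at f C0 C1.

(** Q_f(z) = z f'(z) / f(z), with its removable value Q_f(0) = 1 *)
Definition Qf (f : C -> C) (z : C) : C :=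
  if Req_EM_T (fst z) 0 then
    (if Req_EM_T (snd z) 0 then C1 else Cdiv (Cmul z (Cderiv f z)) (f z))
  else Cdiv (Cmul z (Cderiv f z)) (f z).

Definition subordinate (F G : C -> C) : Prop :=
  exists w : C -> C, analytic_on_D w /\ w C0 = C0 /\
    (forall z, in_D z -> in_D (w z)) /\
    (forall z, in_D z -> F z = G (w z)).

Definition Sstar (phi : C -> C) (f : C -> C) : Prop :=
  classA f /\ subordinate (Qf f) phi.

Definition phiNe (z : C) : C :=
  Csub (Cadd C1 z) (Cdiv (Cmul z (Cmul z z)) (RtoC 3)).
Definition in_OmegaNe (u : C) : Prop := exists v, in_D v /\ u = phiNe v.

Definition phiRL (z : C) : C :=
  Csub (RtoC (sqrt 2))
    (Cmul (RtoC (sqrt 2 - 1))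
      (Csqrt (Cdiv (Csub C1 z)
                   (Cadd C1 (Cmul (RtoC (2 * (sqrt 2 - 1))) z))))).

Definition phiC (z : C) : C :=
  Cadd (Cadd C1 (Cmul (RtoC (4/3)) z)) (Cmul (RtoC (2/3)) (Cmul z z)).

Definition kR : R := sqrt 2 + 1.
Definition phi0 (z : C) : C :=
  Cadd C1 (Cmul (Cdiv z (RtoC kR))
                (Cdiv (Cadd (RtoC kR) z) (Csub (RtoC kR) z))).

Definition SstarNe := Sstar phiNe.
Definition SstarRL := Sstar phiRL.
Definition SstarC := Sstar phiC.
Definition SstarR := Sstar phi0.

Definition NeRadiusOK (G : (C -> C) -> Prop) (rho : R) : Prop :=
  0 < rho <= 1 /\
  forall f, G f -> forall z, in_disk rho z -> in_OmegaNe (Qf f z).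

Definition is_Ne_radius (G : (C -> C) -> Prop) (rho : R) : Prop :=
  NeRadiusOK G rho /\ forall rho', NeRadiusOK G rho' -> rho' <= rho.

(* Main.v *)
(* A function [f] of the class has [Qf f = phi o w] with [w] a Schwarz function, so [Qf f] maps the disk of radius rho into the image [phi (D_rho)] by the Schwarz lemma.  Here [|phi - 1| < 2/3] on [D_rho], and the nephroid domain contains the disk of radius 2/3 about 1 because [w = v - v^3/3] is solved by a contraction.  Sharpness comes from [f(z) = z exp (int_0^z (phi(t) - 1)/t dt)], for which [Qf f] takes at [rho] or [- rho] the value 5/3 or 1/3, a cusp of the nephroid.
   The derivative is only assumed to exist pointwise, so the Schwarz lemma and the primitive both rest on Goursat's theorem for rectangles. *)

Require Import Defs.
From Stdlib Require Import Reals Lra Classical ClassicalEpsilon.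
From Coquelicot Require Import Coquelicot.
Open Scope R_scope.

(** * Complex differentiation in Caratheodory's form *)

(** The cusps 1/3 and 5/3 are omitted by the nephroid domain, so no wider disk about 1 fits into it
    and the disk test can be exact. Each radius is the first r at which |phi - 1| reaches 2/3 on the
    circle |z| = r, and it does so on the real axis: at r for the quadratic and the rational
    function, where the triangle inequality becomes an equality, and at -r for the square root,
    where the estimate is carried out on the value of the root instead. The delicate object in the
    Schwarz lemma is the quotient w(z)/z, which is continuous at 0 but not known to be
    differentiable there. Removability of that point is avoided: the mean value property and the
    maximum principle are proved for functions differentiable off one point and continuous at it. A
    logarithmic coordinate makes this possible, because the exponential omits 0 and a rectangle in
    that coordinate never meets the centre. *)

Definition ccont (f : C -> C) (z : C) : Prop :=
  forall eps, 0 < eps -> exists delta, 0 < delta /\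
    forall w, Cmod (w - z) < delta -> Cmod (f w - f z) < eps.

(** The factor [q] is total and the identity holds at every point, with no case w = z and no
    division. The sum, product and chain rules thus reduce to algebra and to continuity of [q] at z.
    The factor is also reused directly: it is the quotient in the Schwarz lemma. *)
Definition cderiv (f : C -> C) (z l : C) : Prop :=
  exists q : C -> C, ccont q z /\ q z = l /\
    forall w, f w = (f z + q w * (w - z))%C.

Lemma C_eq (z w : C) : Re z = Re w -> Im z = Im w -> z = w.
Proof.
  destruct z, w; unfold Re, Im; simpl; intros -> ->; reflexivity.
Qed.

Lemma Cmod_sqr (z : C) : Cmod z * Cmod z = Re z * Re z + Im z * Im z.
Proof.
  generalize (Cmod2_alt z); simpl; lra.
Qed.

Lemma Cmod_lt_sqr (z : C) (r : R) :
  0 <= r -> (Cmod z < r <-> Re z * Re z + Im z * Im z < r * r).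
Proof.
  intros Hr; generalize (Cmod_ge_0 z) (Cmod_sqr z); intros; split; intros; nra.
Qed.

Lemma Cmod_im_le (z : C) : Rabs (Im z) <= Cmod z.
Proof.
  generalize (Cmod_ge_0 z) (Cmod_sqr z); intros; apply Rabs_le; split; nra.
Qed.

Lemma Cmod_le_abs (z : C) : Cmod z <= Rabs (Re z) + Rabs (Im z).
Proof.
  generalize (Cmod_ge_0 z) (Cmod_sqr z) (Rabs_pos (Re z)) (Rabs_pos (Im z))
    (Rsqr_abs (Re z)) (Rsqr_abs (Im z)); unfold Rsqr; intros; nra.
Qed.

Lemma Cmod_sub_sym (z w : C) : Cmod (z - w) = Cmod (w - z).
Proof.
  rewrite <- Cmod_opp; f_equal; ring.
Qed.

Lemma Cmod_sub_self (z : C) : Cmod (z - z) = 0.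
Proof.
  replace (z - z)%C with (RtoC 0) by ring; apply Cmod_0.
Qed.

Lemma Cmod_triangle_sub (z w : C) : Cmod (z - w) <= Cmod z + Cmod w.
Proof.
  replace (z - w)%C with (z + - w)%C by ring; rewrite <- (Cmod_opp w);
    apply Cmod_triangle.
Qed.

Lemma Cmod_triangle_rev (z w : C) : Cmod z - Cmod w <= Cmod (z - w).
Proof.
  generalize (Cmod_triangle (z - w) w); replace (z - w + w)%C with z by ring; lra.
Qed.

Lemma ccont_ext_loc (f g : C -> C) (z : C) (d : R) :
  0 < d -> (forall w, Cmod (w - z) < d -> f w = g w) -> ccont f z -> ccont g z.
Proof.
  intros Hd He Hf eps Heps.
  destruct (Hf eps Heps) as [d1 [H1 K1]].
  exists (Rmin d d1); split; [now apply Rmin_glb_lt|intros w Hw].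
  rewrite <- !He; [|rewrite Cmod_sub_self; lra
    |exact (Rlt_le_trans _ _ _ Hw (Rmin_l _ _))].
  apply K1; exact (Rlt_le_trans _ _ _ Hw (Rmin_r _ _)).
Qed.

Lemma ccont_const (c z : C) : ccont (fun _ => c) z.
Proof.
  intros eps Heps; exists 1; split; [lra|intros; rewrite Cmod_sub_self; lra].
Qed.

Lemma ccont_id (z : C) : ccont (fun w => w) z.
Proof.
  intros eps Heps; exists eps; split; auto.
Qed.

Lemma ccont_plus (f g : C -> C) (z : C) :
  ccont f z -> ccont g z -> ccont (fun w => f w + g w)%C z.
Proof.
  intros Hf Hg eps Heps.
  destruct (Hf (eps / 2)) as [d1 [H1 K1]]; [lra|].
  destruct (Hg (eps / 2)) as [d2 [H2 K2]]; [lra|].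
  exists (Rmin d1 d2); split; [now apply Rmin_glb_lt|intros w Hw].
  generalize (K1 w (Rlt_le_trans _ _ _ Hw (Rmin_l _ _)))
    (K2 w (Rlt_le_trans _ _ _ Hw (Rmin_r _ _)))
    (Cmod_triangle (f w - f z) (g w - g z)).
  replace (f w + g w - (f z + g z))%C with (f w - f z + (g w - g z))%C by ring.
  lra.
Qed.

Lemma ccont_mult (f g : C -> C) (z : C) :
  ccont f z -> ccont g z -> ccont (fun w => f w * g w)%C z.
Proof.
  intros Hf Hg eps Heps.
  set (A := Cmod (f z) + Cmod (g z) + 1).
  assert (HA : 1 <= A)
    by (generalize (Cmod_ge_0 (f z)) (Cmod_ge_0 (g z)); unfold A; lra).
  set (e := Rmin 1 (eps / A)).
  assert (He : 0 < e)
    by (apply Rmin_glb_lt; [lra|apply Rdiv_lt_0_compat; lra]).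
  destruct (Hf e He) as [d1 [H1 K1]].
  destruct (Hg e He) as [d2 [H2 K2]].
  exists (Rmin d1 d2); split; [now apply Rmin_glb_lt|intros w Hw].
  generalize (K1 w (Rlt_le_trans _ _ _ Hw (Rmin_l _ _)))
    (K2 w (Rlt_le_trans _ _ _ Hw (Rmin_r _ _))).
  replace (f w * g w - f z * g z)%C
    with ((f w - f z) * (g w - g z) + (f z * (g w - g z) + (f w - f z) * g z))%C
    by ring.
  generalize (Cmod_triangle ((f w - f z) * (g w - g z))
     (f z * (g w - g z) + (f w - f z) * g z))
    (Cmod_triangle (f z * (g w - g z)) ((f w - f z) * g z)).
  rewrite !Cmod_mult.
  generalize (Cmod_ge_0 (f w - f z)) (Cmod_ge_0 (g w - g z))
    (Cmod_ge_0 (f z)) (Cmod_ge_0 (g z)).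
  generalize (Rmin_l 1 (eps / A)) (Rmin_r 1 (eps / A)); fold e.
  intros Ha Hb.
  assert (Hc : e * A <= eps).
  { replace eps with (eps / A * A) by (field; lra). nra. }
  unfold A in Hc. intros.
  assert (Cmod (f w - f z) * Cmod (g w - g z) < e * 1) by nra.
  assert (Cmod (f z) * Cmod (g w - g z) <= Cmod (f z) * e) by nra.
  assert (Cmod (f w - f z) * Cmod (g z) <= e * Cmod (g z)) by nra.
  nra.
Qed.

Lemma ccont_opp (f : C -> C) (z : C) : ccont f z -> ccont (fun w => - f w)%C z.
Proof.
  intros H; apply (ccont_ext_loc (fun w => (- RtoC 1) * f w)%C _ _ 1); [lra| |].
  - intros w _; ring.
  - apply ccont_mult; [apply ccont_const|exact H].
Qed.

Lemma ccont_comp (f g : C -> C) (z : C) :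
  ccont f (g z) -> ccont g z -> ccont (fun w => f (g w)) z.
Proof.
  intros Hf Hg eps Heps.
  destruct (Hf eps Heps) as [d1 [H1 K1]].
  destruct (Hg d1 H1) as [d2 [H2 K2]].
  exists d2; split; auto.
Qed.

Lemma ccont_inv (z : C) : z <> RtoC 0 -> ccont Cinv z.
Proof.
  intros Hz eps Heps.
  assert (Hm : 0 < Cmod z) by now apply Cmod_gt_0.
  set (m := Cmod z) in *.
  exists (Rmin (m / 2) (eps * m * m / 2)); split.
  { apply Rmin_glb_lt; [lra|]. assert (0 < eps * m * m) by (repeat apply Rmult_lt_0_compat; lra). lra. }
  intros w Hw.
  assert (H1 := Rlt_le_trans _ _ _ Hw (Rmin_l _ _)).
  assert (H2 := Rlt_le_trans _ _ _ Hw (Rmin_r _ _)).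
  assert (Hwm : m / 2 < Cmod w).
  { generalize (Cmod_triangle_rev z w). rewrite Cmod_sub_sym. fold m. lra. }
  assert (Hw0 : w <> RtoC 0) by (apply Cmod_gt_0; lra).
  replace (/ w - / z)%C with ((z - w) / (w * z))%C by (field; auto).
  rewrite Cmod_div by (now apply Cmult_neq_0).
  rewrite Cmod_mult, Cmod_sub_sym. fold m.
  apply Rlt_div_l; [nra|].
  assert (m / 2 * (eps * m) < Cmod w * (eps * m)) by (apply Rmult_lt_compat_r; nra).
  nra.
Qed.

Lemma cderiv_ccont (f : C -> C) (z l : C) : cderiv f z l -> ccont f z.
Proof.
  intros [q [Hq [_ He]]].
  apply (ccont_ext_loc (fun w => f z + q w * (w + - z))%C _ _ 1); [lra| |].
  - intros w _; now rewrite (He w).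
  - apply ccont_plus; [apply ccont_const|].
    apply ccont_mult; [exact Hq|].
    apply ccont_plus; [apply ccont_id|apply ccont_const].
Qed.

Lemma cderiv_eq (f : C -> C) (z l l' : C) : cderiv f z l -> l = l' -> cderiv f z l'.
Proof.
  intros H ->; exact H.
Qed.

Lemma cderiv_const (c z : C) : cderiv (fun _ => c) z (RtoC 0).
Proof.
  exists (fun _ => RtoC 0); repeat split; [apply ccont_const|intros; ring].
Qed.

Lemma cderiv_id (z : C) : cderiv (fun w => w) z (RtoC 1).
Proof.
  exists (fun _ => RtoC 1); repeat split; [apply ccont_const|intros; ring].
Qed.

Lemma cderiv_plus (f g : C -> C) (z l m : C) :
  cderiv f z l -> cderiv g z m -> cderiv (fun w => f w + g w)%C z (l + m)%C.
Proof.
  intros [q [Hq [<- He]]] [p [Hp [<- Hf]]].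
  exists (fun w => q w + p w)%C; repeat split; [now apply ccont_plus|].
  intros w; rewrite (He w), (Hf w); ring.
Qed.

Lemma cderiv_mult (f g : C -> C) (z l m : C) :
  cderiv f z l -> cderiv g z m ->
  cderiv (fun w => f w * g w)%C z (l * g z + f z * m)%C.
Proof.
  intros Df Dg; assert (Hg := cderiv_ccont _ _ _ Dg); revert Df Dg.
  intros [q [Hq [<- He]]] [p [Hp [<- Hf]]].
  exists (fun w => q w * g w + f z * p w)%C; repeat split.
  - apply ccont_plus; apply ccont_mult; auto; apply ccont_const.
  - intros w; rewrite (He w), (Hf w); ring.
Qed.

Lemma cderiv_scal (f : C -> C) (c z l : C) :
  cderiv f z l -> cderiv (fun w => c * f w)%C z (c * l)%C.
Proof.
  intros H; eapply cderiv_eq;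
    [exact (cderiv_mult _ _ _ _ _ (cderiv_const c z) H)|cbv beta; ring].
Qed.

Lemma cderiv_comp (f g : C -> C) (z l m : C) :
  cderiv f (g z) l -> cderiv g z m -> cderiv (fun w => f (g w)) z (l * m)%C.
Proof.
  intros Df Dg; assert (Hg := cderiv_ccont _ _ _ Dg); revert Df Dg.
  intros [q [Hq [<- He]]] [p [Hp [<- Hf]]].
  exists (fun w => q (g w) * p w)%C; repeat split.
  - apply ccont_mult; auto; now apply (ccont_comp q g).
  - intros w. rewrite (He (g w)). rewrite (Hf w) at 2. ring.
Qed.

Lemma cderiv_ext_loc (f g : C -> C) (z l : C) (d : R) :
  0 < d -> (forall w, Cmod (w - z) < d -> f w = g w) ->
  cderiv f z l -> cderiv g z l.
Proof.
  intros Hd Hfg [q [Hq [Hl He]]].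
  assert (Hz : f z = g z) by (apply Hfg; rewrite Cmod_sub_self; lra).
  (* The identity is required at all w, so beyond distance d the factor is the difference quotient
     of [g] itself. *)
  exists (fun w => if Rlt_dec (Cmod (w - z)) d then q w
     else ((g w - g z) / (w - z))%C); repeat split.
  - apply (ccont_ext_loc q _ _ d); auto.
    intros w Hw; destruct Rlt_dec; easy.
  - destruct Rlt_dec as [_|H]; auto. rewrite Cmod_sub_self in H; lra.
  - intros w; destruct Rlt_dec as [H|H].
    + rewrite <- Hz, <- Hfg; auto.
    + field. intros E.
      apply H. rewrite E, Cmod_0; lra.
Qed.

Lemma cderiv_opp (f : C -> C) (z l : C) :
  cderiv f z l -> cderiv (fun w => - f w)%C z (- l)%C.
Proof.
  intros H; apply (cderiv_ext_loc (fun w => (- RtoC 1) * f w)%C _ _ _ 1); [lra| |].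
  - intros w _; ring.
  - eapply cderiv_eq; [apply cderiv_scal; exact H|ring].
Qed.

Lemma cderiv_inv (f : C -> C) (z l : C) :
  cderiv f z l -> f z <> RtoC 0 ->
  cderiv (fun w => / f w)%C z (- l / (f z * f z))%C.
Proof.
  intros D Hz.
  apply (cderiv_eq _ _ (- / (f z * f z) * l)%C); [|field; auto].
  apply (cderiv_comp Cinv); [|exact D].
  set (a := f z) in *.
  assert (Ha : 0 < Cmod a) by now apply Cmod_gt_0.
  (* The factor -1/(aw) gives the right identity except at w = 0, where [Cinv] has a default value.
     Outside the disk of radius |a| about a, which does not contain 0, the function is replaced by
     the one that satisfies the identity by definition. *)
  apply (cderiv_ext_loc
    (fun w => if Rlt_dec (Cmod (w - a)) (Cmod a) then / w else / a + - / (a * w) * (w - a))%C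
     _ _ _ (Cmod a)); auto.
  { intros w Hw; destruct Rlt_dec; easy. }
  exists (fun w => - / (a * w))%C; repeat split.
  - apply (ccont_ext_loc (fun w => - / a * / w)%C _ _ (Cmod a)); auto.
    + intros w Hw. assert (w <> RtoC 0).
      { apply Cmod_gt_0. generalize (Cmod_triangle_rev a w). rewrite Cmod_sub_sym. lra. }
      field; auto.
    + apply ccont_mult; [apply ccont_const|now apply ccont_inv].
  - intros w. rewrite Cmod_sub_self. destruct (Rlt_dec 0 (Cmod a)); [|lra].
    destruct Rlt_dec as [H|H]; auto.
    assert (w <> RtoC 0).
    { apply Cmod_gt_0. generalize (Cmod_triangle_rev a w). rewrite Cmod_sub_sym. lra. }
    field; auto.
Qed.

Lemma cderiv_bound (f : C -> C) (z l : C) (eps : R) :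
  cderiv f z l -> 0 < eps -> exists delta, 0 < delta /\
    forall w, Cmod (w - z) < delta ->
      Cmod (f w - f z - l * (w - z)) <= eps * Cmod (w - z).
Proof.
  intros [q [Hq [<- He]]] Heps.
  destruct (Hq eps Heps) as [d [Hd K]].
  exists d; split; auto; intros w Hw; rewrite (He w).
  replace (f z + q w * (w - z) - f z - q z * (w - z))%C
    with ((q w - q z) * (w - z))%C by ring.
  rewrite Cmod_mult; apply Rmult_le_compat_r; [apply Cmod_ge_0|].
  left; auto.
Qed.

Lemma cderiv_of_bound (f : C -> C) (z l : C) :
  (forall eps, 0 < eps -> exists delta, 0 < delta /\
    forall w, Cmod (w - z) < delta ->
      Cmod (f w - f z - l * (w - z)) <= eps * Cmod (w - z)) ->
  cderiv f z l.
Proof.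
  intros H.
  exists (fun w => if Ceq_dec w z then l else ((f w - f z) / (w - z))%C).
  assert (Hne : forall w, w <> z -> (w - z)%C <> RtoC 0).
  { intros w Hw E; apply Hw. replace w with (w - z + z)%C by ring. rewrite E; ring. }
  repeat split.
  - intros eps Heps. destruct (H (eps / 2)) as [d [Hd K]]; [lra|].
    exists d; split; auto; intros w Hw.
    destruct (Ceq_dec z z) as [_|]; [|easy].
    destruct (Ceq_dec w z) as [->|E]; [rewrite Cmod_sub_self; lra|].
    assert (Hp : 0 < Cmod (w - z)) by (apply Cmod_gt_0; auto).
    replace ((f w - f z) / (w - z) - l)%C
      with ((f w - f z - l * (w - z)) / (w - z))%C by (field; auto).
    rewrite Cmod_div by auto. apply Rlt_div_l; auto.
    generalize (K w Hw); nra.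
  - destruct (Ceq_dec z z); easy.
  - intros w. destruct (Ceq_dec w z) as [->|E]; [ring|].
    field; auto.
Qed.

Lemma cderiv_unique (f : C -> C) (z l m : C) : cderiv f z l -> cderiv f z m -> l = m.
Proof.
  intros Hl Hm.
  destruct (Ceq_dec l m) as [|E]; auto; exfalso.
  assert (Hp : 0 < Cmod (l - m)).
  { apply Cmod_gt_0; intros E'; apply E. replace l with (l - m + m)%C by ring. rewrite E'; ring. }
  destruct (cderiv_bound f z l (Cmod (l - m) / 4) Hl) as [d1 [H1 K1]]; [lra|].
  destruct (cderiv_bound f z m (Cmod (l - m) / 4) Hm) as [d2 [H2 K2]]; [lra|].
  set (h := Rmin d1 d2 / 2).
  assert (Hh : 0 < Rmin d1 d2) by now apply Rmin_glb_lt.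
  assert (Ew : Cmod ((z + RtoC h) - z) = h).
  { replace (z + RtoC h - z)%C with (RtoC h) by ring.
    rewrite Cmod_R. apply Rabs_pos_eq; unfold h; lra. }
  assert (Hl1 := Rmin_l d1 d2). assert (Hl2 := Rmin_r d1 d2).
  assert (B1 : Cmod (z + RtoC h - z) < d1) by (rewrite Ew; unfold h; lra).
  assert (B2 : Cmod (z + RtoC h - z) < d2) by (rewrite Ew; unfold h; lra).
  apply K1 in B1. apply K2 in B2. rewrite Ew in B1, B2.
  replace (z + RtoC h - z)%C with (RtoC h) in B1, B2 by ring.
  assert (B := Cmod_triangle_sub (f (z + RtoC h) - f z - l * RtoC h)%C (f (z + RtoC h) - f z - m * RtoC h)%C).
  replace (f (z + RtoC h) - f z - l * RtoC h - (f (z + RtoC h) - f z - m * RtoC h))%C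
    with (- ((l - m) * RtoC h))%C in B by ring.
  rewrite Cmod_opp, Cmod_mult, Cmod_R, Rabs_pos_eq in B by (unfold h; lra).
  assert (0 < h) by (unfold h; lra). nra.
Qed.

(** * Agreement with the arithmetic and the derivative of the statement *)

Lemma Defs_Cinv_E (z : C) : Defs.Cinv z = Cinv z.
Proof.
  destruct z as [x y]; unfold Defs.Cinv, Cinv; simpl.
  replace (x * (x * 1) + y * (y * 1)) with (x * x + y * y) by ring.
  destruct Req_EM_T as [E|E]; auto.
  assert (x = 0) by nra. assert (y = 0) by nra. subst.
  unfold C0; f_equal; unfold Rdiv; ring.
Qed.

Lemma Cnorm_E (z : C) : Cnorm z = Cmod z.
Proof.
  unfold Cnorm, Cmod; f_equal; ring.
Qed.

Lemma Defs_Cadd_E (z w : C) : Cadd z w = (z + w)%C. Proof. reflexivity. Qed.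
Lemma Defs_Csub_E (z w : C) : Csub z w = (z - w)%C. Proof. reflexivity. Qed.
Lemma Defs_Cdiv_E (z w : C) : Defs.Cdiv z w = (z / w)%C.
Proof.
  unfold Defs.Cdiv; rewrite Defs_Cinv_E; reflexivity.
Qed.

Lemma Cderiv_at_iff (f : C -> C) (z l : C) : Cderiv_at f z l <-> cderiv f z l.
Proof.
  unfold Cderiv_at; setoid_rewrite Cnorm_E; setoid_rewrite Defs_Cdiv_E.
  split.
  - intros H. apply cderiv_of_bound. intros eps Heps.
    destruct (H eps Heps) as [d [Hd K]]. exists d; split; auto. intros w Hw.
    destruct (Ceq_dec w z) as [->|E].
    { replace (f z - f z - l * (z - z))%C with (RtoC 0) by ring.
      rewrite Cmod_sub_self, Cmod_0; lra. }
    assert (Hne : (w - z)%C <> RtoC 0).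
    { intros E'; apply E. replace w with (w - z + z)%C by ring. rewrite E'; ring. }
    specialize (K (w - z)%C Hne Hw).
    rewrite !Defs_Csub_E, Defs_Cadd_E in K.
    replace (z + (w - z))%C with w in K by ring.
    replace (f w - f z - l * (w - z))%C with (((f w - f z) / (w - z) - l) * (w - z))%C
      by (field; auto).
    rewrite Cmod_mult. apply Rmult_le_compat_r; [apply Cmod_ge_0|left; exact K].
  - intros [q [Hq [<- He]]] eps Heps. destruct (Hq eps Heps) as [d [Hd K]].
    exists d; split; auto. refine (fun (h : C) Hh Hm => _).
    change (Cmod ((f (z + h) - f z) / h - q z)%C < eps). rewrite (He (z + h)%C).
    assert (h <> RtoC 0) by exact Hh.
    replace ((f z + q (z + h)%C * (z + h - z) - f z) / h)%C with (q (z + h)%C)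
      by (field; auto).
    apply K. replace (z + h - z)%C with h by ring. exact Hm.
Qed.

(** * Goursat's theorem *)

Lemma nested_intervals (a b : nat -> R) :
  (forall n, a n <= b n) ->
  (forall n, a n <= a (S n) /\ b (S n) <= b n) ->
  exists x, forall n, a n <= x <= b n.
Proof.
  intros Hab Hmon.
  assert (Ha : forall n m, a n <= a (n + m)%nat).
  { induction m; [rewrite Nat.add_0_r; lra|].
    rewrite Nat.add_succ_r; generalize (Hmon (n + m)%nat); lra. }
  assert (Hb : forall n m, b (n + m)%nat <= b n).
  { induction m; [rewrite Nat.add_0_r; lra|].
    rewrite Nat.add_succ_r; generalize (Hmon (n + m)%nat); lra. }
  assert (Hc : forall n m, a n <= b m).
  { intros n m; generalize (Ha n m) (Hb m n) (Hab (n + m)%nat).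
    rewrite (Nat.add_comm m n); lra. }
  destruct (completeness (fun y => exists n, y = a n)) as [x [Hx1 Hx2]].
  - exists (b 0%nat); intros y [n ->]; apply Hc.
  - exists (a 0%nat), 0%nat; reflexivity.
  - exists x; intros n; split.
    + apply Hx1; exists n; reflexivity.
    + apply Hx2; intros y [m ->]; apply Hc.
Qed.

Lemma half_pow_small (w d : R) : 0 < d -> exists n, w * (/ 2) ^ n < d.
Proof.
  intros Hd.
  destruct (pow_lt_1_zero (/ 2)) with (y := d / (Rabs w + 1)) as [n Hn].
  - rewrite Rabs_pos_eq; lra.
  - apply Rdiv_lt_0_compat; auto; generalize (Rabs_pos w); lra.
  - exists n; specialize (Hn n (le_n n)).
    assert (H1 := Rabs_pos w). assert (H2 := Rle_abs w).
    assert (H3 : 0 < (/ 2) ^ n) by (apply pow_lt; lra).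
    rewrite Rabs_pos_eq in Hn by lra.
    apply Rlt_div_r in Hn; [|lra]. nra.
Qed.

Definition half_interval (a b a' b' : R) : Prop :=
  (a' = a /\ b' = (a + b) / 2) \/ (a' = (a + b) / 2 /\ b' = b).

(* Cantor's nested rectangles: a property inherited by one of the four quarters concentrates at a point. *)
Lemma rectangle_bisection (P : R -> R -> R -> R -> Prop) (a b c d : R) :
  (forall a b c d, a <= b -> c <= d -> P a b c d ->
     exists a' b' c' d', half_interval a b a' b' /\ half_interval c d c' d' /\
       P a' b' c' d') ->
  a <= b -> c <= d -> P a b c d ->
  exists x y, a <= x <= b /\ c <= y <= d /\
    forall delta, 0 < delta -> exists a' b' c' d',
      a <= a' <= x /\ x <= b' <= b /\ c <= c' <= y /\ y <= d' <= d /\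
      b' - a' < delta /\ d' - c' < delta /\ P a' b' c' d'.
Proof.
  intros Hstep Hab Hcd HP.
  set (ok := fun r : (R * R) * (R * R) =>
    fst (fst r) <= snd (fst r) /\ fst (snd r) <= snd (snd r) /\
    P (fst (fst r)) (snd (fst r)) (fst (snd r)) (snd (snd r))).
  set (nxt := fun r r' : (R * R) * (R * R) =>
    half_interval (fst (fst r)) (snd (fst r)) (fst (fst r')) (snd (fst r')) /\
    half_interval (fst (snd r)) (snd (snd r)) (fst (snd r')) (snd (snd r'))).
  (* Dependent choice: a good quarter is selected for every admissible rectangle, so that the
     sequence [s] is an ordinary recursion. *)
  assert (Hex : forall r : sig ok, { r' : sig ok | nxt (proj1_sig r) (proj1_sig r') }).
  { intros [[[a0 b0] [c0 d0]] [K1 [K2 K3]]]; simpl in *.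
    apply constructive_indefinite_description.
    destruct (Hstep _ _ _ _ K1 K2 K3) as [a1 [b1 [c1 [d1 [L1 [L2 L3]]]]]].
    assert (K : ok ((a1, b1), (c1, d1))).
    { unfold ok, half_interval in *; simpl; repeat split; auto; lra. }
    exists (exist _ _ K); split; auto. }
  assert (K0 : ok ((a, b), (c, d))) by (repeat split; auto).
  set (s := fix s (n : nat) : sig ok := match n with
     | O => exist _ _ K0 | S m => proj1_sig (Hex (s m)) end).
  set (A := fun n => fst (fst (proj1_sig (s n)))).
  set (B := fun n => snd (fst (proj1_sig (s n)))).
  set (E := fun n => fst (snd (proj1_sig (s n)))).
  set (F := fun n => snd (snd (proj1_sig (s n)))).
  assert (Hok : forall n, A n <= B n /\ E n <= F n /\ P (A n) (B n) (E n) (F n))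
    by (intros n; apply (proj2_sig (s n))).
  assert (Hn : forall n, half_interval (A n) (B n) (A (S n)) (B (S n)) /\
     half_interval (E n) (F n) (E (S n)) (F (S n)))
    by (intros n; exact (proj2_sig (Hex (s n)))).
  unfold half_interval in Hn.
  assert (HA : forall n, A n <= A (S n) /\ B (S n) <= B n)
    by (intros n; generalize (Hok n) (Hn n); lra).
  assert (HE : forall n, E n <= E (S n) /\ F (S n) <= F n)
    by (intros n; generalize (Hok n) (Hn n); lra).
  destruct (nested_intervals A B) as [x Hx]; [apply Hok|apply HA|].
  destruct (nested_intervals E F) as [y Hy]; [apply Hok|apply HE|].
  assert (Hin : forall n, a <= A n /\ B n <= b /\ c <= E n /\ F n <= d /\
     B n - A n = (b - a) * (/ 2) ^ n /\ F n - E n = (d - c) * (/ 2) ^ n).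
  { induction n as [|n IH].
    - unfold A, B, E, F; simpl; lra.
    - generalize (HA n) (HE n) (Hn n); simpl pow; lra. }
  exists x, y; split; [exact (Hx 0%nat)|split; [exact (Hy 0%nat)|]].
  intros delta Hdelta.
  destruct (half_pow_small ((b - a) + (d - c)) delta Hdelta) as [n H].
  exists (A n), (B n), (E n), (F n).
  assert (0 < (/ 2) ^ n) by (apply pow_lt; lra).
  assert (0 <= (b - a) * (/ 2) ^ n) by (apply Rmult_le_pos; lra).
  assert (0 <= (d - c) * (/ 2) ^ n) by (apply Rmult_le_pos; lra).
  generalize (Hok n) (Hx n) (Hy n) (Hin n); intros; intuition lra.
Qed.

(** Bisection of the property that the part of the disk inside the rectangle dominates the whole
    disk: every value of [f] is matched or exceeded there. At the limit point p, a value f z > f p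
    would be matched by points arbitrarily near p, against continuity. *)
Lemma disk_extreme_value (f : C -> R) (r : R) :
  0 <= r ->
  (forall z, Cmod z <= r -> forall eps, 0 < eps -> exists delta, 0 < delta /\
     forall w, Cmod (w - z) < delta -> Rabs (f w - f z) < eps) ->
  exists p, Cmod p <= r /\ forall z, Cmod z <= r -> f z <= f p.
Proof.
  intros Hr Hf.
  set (P := fun a b c d => forall z, Cmod z <= r -> exists w,
    a <= Re w <= b /\ c <= Im w <= d /\ Cmod w <= r /\ f z <= f w).
  destruct (rectangle_bisection P (- r) r (- r) r) as [x [y [_ [_ H]]]]; try lra.
  - intros a b c d Hab Hcd HP.
    set (m := (a + b) / 2); set (n := (c + d) / 2).
    apply NNPP; intros Hno.
    assert (Hall : forall a' b' c' d', half_interval a b a' b' -> half_interval c d c' d' ->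
      exists z, Cmod z <= r /\ forall w, a' <= Re w <= b' -> c' <= Im w <= d' ->
         Cmod w <= r -> f w < f z).
    { intros a' b' c' d' H1 H2. apply NNPP; intros H3. apply Hno.
      exists a', b', c', d'; repeat split; auto.
      intros z Hz. apply NNPP; intros H4. apply H3. exists z; split; auto.
      intros w W1 W2 W3. apply Rnot_le_lt; intros W4. apply H4.
      exists w; tauto. }
    destruct (Hall a m c n) as [z1 [Z1 K1]]; [unfold half_interval, m, n; lra..|].
    destruct (Hall m b c n) as [z2 [Z2 K2]]; [unfold half_interval, m, n; lra..|].
    destruct (Hall a m n d) as [z3 [Z3 K3]]; [unfold half_interval, m, n; lra..|].
    destruct (Hall m b n d) as [z4 [Z4 K4]]; [unfold half_interval, m, n; lra..|].
    (* If each quarter is beaten by some point, the best of the four points beats the whole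
       rectangle. *)
    assert (Hbest : exists z, Cmod z <= r /\ f z1 <= f z /\ f z2 <= f z /\
        f z3 <= f z /\ f z4 <= f z).
    { destruct (Rle_dec (f z1) (f z2)), (Rle_dec (f z3) (f z4)).
      - destruct (Rle_dec (f z2) (f z4)); [exists z4|exists z2]; repeat split; auto; lra.
      - destruct (Rle_dec (f z2) (f z3)); [exists z3|exists z2]; repeat split; auto; lra.
      - destruct (Rle_dec (f z1) (f z4)); [exists z4|exists z1]; repeat split; auto; lra.
      - destruct (Rle_dec (f z1) (f z3)); [exists z3|exists z1]; repeat split; auto; lra. }
    destruct Hbest as [z [Hz Hz4]].
    destruct (HP z Hz) as [w [W1 [W2 [W3 W4]]]].
    specialize (K1 w); specialize (K2 w); specialize (K3 w); specialize (K4 w).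
    destruct (Rle_dec (Re w) m), (Rle_dec (Im w) n).
    + specialize (K1 ltac:(lra) ltac:(lra) W3); lra.
    + specialize (K3 ltac:(lra) ltac:(lra) W3); lra.
    + specialize (K2 ltac:(lra) ltac:(lra) W3); lra.
    + specialize (K4 ltac:(lra) ltac:(lra) W3); lra.
  - intros z Hz; exists z.
    assert (H1 := re_le_Cmod z). assert (H2 := Cmod_im_le z).
    apply Rabs_le_between in H1. apply Rabs_le_between in H2. repeat split; auto; lra.
  - set (p := (x, y) : C).
    assert (Hnear : forall delta, 0 < delta -> forall z, Cmod z <= r ->
       exists w, Cmod (w - p) < delta /\ Cmod w <= r /\ f z <= f w).
    { intros delta Hd z Hz.
      destruct (H (delta / 2)) as [a [b [c [d [B1 [B2 [B3 [B4 [B5 [B6 B7]]]]]]]]]]; [lra|].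
      destruct (B7 z Hz) as [w [W1 [W2 [W3 W4]]]].
      exists w; repeat split; auto.
      eapply Rle_lt_trans; [apply Cmod_le_abs|].
      assert (Rabs (Re (w - p)%C) < delta / 2).
      { apply Rabs_lt_between. destruct w as [u v]; unfold p, Re, Im in *; simpl in *; lra. }
      assert (Rabs (Im (w - p)%C) < delta / 2).
      { apply Rabs_lt_between. destruct w as [u v]; unfold p, Re, Im in *; simpl in *; lra. }
      lra. }
    assert (Hp : Cmod p <= r).
    { apply Rnot_lt_le; intros K.
      destruct (Hnear (Cmod p - r) ltac:(lra) (RtoC 0) ltac:(rewrite Cmod_0; lra))
        as [w [W1 [W2 _]]].
      generalize (Cmod_triangle_rev p w). rewrite Cmod_sub_sym; lra. }
    exists p; split; auto. intros z Hz.
    apply Rnot_lt_le; intros K.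
    destruct (Hf p Hp (f z - f p) ltac:(lra)) as [delta [D1 D2]].
    destruct (Hnear delta D1 z Hz) as [w [W1 [W2 W3]]].
    specialize (D2 w W1). apply Rabs_lt_between in D2. lra.
Qed.

(** * Contour integrals over rectangles *)

(** Imaginary part of the counterclockwise integral of h dz: on the vertical sides dz = i dy, and Im
    (i h) = Re h. The real part is the same quantity for i h, so only real integrals occur. *)
Definition im_contour (h : C -> C) (a b c d : R) : R :=
  RInt (fun x => Im (h (x, c))) a b + RInt (fun y => Re (h (b, y))) c d
  - RInt (fun x => Im (h (x, d))) a b - RInt (fun y => Re (h (a, y))) c d.

Lemma continuous_eps (f : R -> R) (x : R) :
  (forall eps, 0 < eps -> exists delta, 0 < delta /\
     forall y, Rabs (y - x) < delta -> Rabs (f y - f x) < eps) -> continuous f x.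
Proof.
  intros H. apply filterlim_locally; intros [eps Heps].
  destruct (H eps Heps) as [d [Hd K]]. exists (mkposreal d Hd).
  intros y Hy; exact (K y Hy).
Qed.

Lemma Cmod_horizontal (x x' y : R) : Cmod ((x', y) - (x, y)) = Rabs (x' - x).
Proof.
  rewrite <- Cmod_R; f_equal; apply C_eq; unfold Re, Im; simpl; ring.
Qed.

Lemma Cmod_vertical (x y y' : R) : Cmod ((x, y') - (x, y)) = Rabs (y' - y).
Proof.
  unfold Cmod; simpl.
  replace ((x + - x) * ((x + - x) * 1) + (y' + - y) * ((y' + - y) * 1))
    with (Rsqr (y' - y)) by (unfold Rsqr; ring).
  apply sqrt_Rsqr_abs.
Qed.

Lemma ccont_im_horizontal (h : C -> C) (x y : R) :
  ccont h (x, y) -> continuous (fun t => Im (h (t, y))) x.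
Proof.
  intros H; apply continuous_eps; intros eps Heps.
  destruct (H eps Heps) as [d [Hd K]]; exists d; split; auto; intros t Ht.
  eapply Rle_lt_trans; [|apply (K (t, y)); now rewrite Cmod_horizontal].
  exact (Cmod_im_le (h (t, y) - h (x, y))%C).
Qed.

Lemma ccont_re_vertical (h : C -> C) (x y : R) :
  ccont h (x, y) -> continuous (fun t => Re (h (x, t))) y.
Proof.
  intros H; apply continuous_eps; intros eps Heps.
  destruct (H eps Heps) as [d [Hd K]]; exists d; split; auto; intros t Ht.
  eapply Rle_lt_trans; [|apply (K (x, t)); now rewrite Cmod_vertical].
  exact (re_le_Cmod (h (x, t) - h (x, y))%C).
Qed.

Definition ccont_rect (h : C -> C) (a b c d : R) : Prop :=
  forall x y, a <= x <= b -> c <= y <= d -> ccont h (x, y).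

Lemma ex_RInt_im_horizontal (h : C -> C) (a b c d u v y : R) :
  ccont_rect h a b c d -> a <= u <= b -> a <= v <= b -> c <= y <= d ->
  ex_RInt (fun x => Im (h (x, y))) u v.
Proof.
  intros H Hu Hv Hy; apply (ex_RInt_continuous (V := R_CompleteNormedModule)); intros x Hx.
  apply ccont_im_horizontal, H; auto.
  unfold Rmin, Rmax in Hx; destruct (Rle_dec u v); lra.
Qed.

Lemma ex_RInt_re_vertical (h : C -> C) (a b c d u v x : R) :
  ccont_rect h a b c d -> c <= u <= d -> c <= v <= d -> a <= x <= b ->
  ex_RInt (fun y => Re (h (x, y))) u v.
Proof.
  intros H Hu Hv Hx; apply (ex_RInt_continuous (V := R_CompleteNormedModule)); intros y Hy.
  apply ccont_re_vertical, H; auto.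
  unfold Rmin, Rmax in Hy; destruct (Rle_dec u v); lra.
Qed.

Lemma im_contour_quarters (h : C -> C) (a m b c n d : R) :
  a <= m <= b -> c <= n <= d -> ccont_rect h a b c d ->
  im_contour h a b c d = im_contour h a m c n + im_contour h m b c n
    + im_contour h a m n d + im_contour h m b n d.
Proof.
  intros Hm Hn H; unfold im_contour.
  assert (E1 : forall y, c <= y <= d -> RInt (fun x => Im (h (x, y))) a b =
     RInt (fun x => Im (h (x, y))) a m + RInt (fun x => Im (h (x, y))) m b).
  { intros y Hy; symmetry.
    apply (RInt_Chasles (V := R_CompleteNormedModule));
      eapply ex_RInt_im_horizontal; eauto; lra. }
  assert (E2 : forall x, a <= x <= b -> RInt (fun y => Re (h (x, y))) c d =
     RInt (fun y => Re (h (x, y))) c n + RInt (fun y => Re (h (x, y))) n d).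
  { intros x Hx; symmetry.
    apply (RInt_Chasles (V := R_CompleteNormedModule));
      eapply ex_RInt_re_vertical; eauto; lra. }
  rewrite !E1, !E2 by lra. ring.
Qed.

Lemma ccont_rect_sub (h : C -> C) (a b c d a' b' c' d' : R) :
  a <= a' -> b' <= b -> c <= c' -> d' <= d ->
  ccont_rect h a b c d -> ccont_rect h a' b' c' d'.
Proof.
  intros; intros x y ? ?; apply H3; lra.
Qed.

Lemma RInt_affine (al be a b : R) :
  RInt (fun x => al + be * x) a b = al * (b - a) + be * (b * b - a * a) / 2.
Proof.
  apply is_RInt_unique.
  replace (al * (b - a) + be * (b * b - a * a) / 2) with
    (minus (al * b + be * b * b / 2) (al * a + be * a * a / 2))
    by (unfold minus, plus, opp; simpl; field).
  apply (is_RInt_derive (fun x => al * x + be * x * x / 2) (fun x => al + be * x)).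
  - intros x _; auto_derive; auto; field.
  - intros x _; apply (continuous_plus (V := R_NormedModule));
      [apply continuous_const|].
    apply (continuous_scal_r be (fun x : R => x)); apply continuous_id.
Qed.

Lemma im_contour_affine (h : C -> C) (p q : C) (a b c d : R) :
  (forall z, h z = (p + q * z)%C) -> im_contour h a b c d = 0.
Proof.
  intros H; unfold im_contour.
  assert (E1 : forall y, RInt (fun x => Im (h (x, y))) a b =
     RInt (fun x => (Im p + Re q * y) + Im q * x) a b).
  { intros y; apply RInt_ext; intros x _; rewrite H; unfold Re, Im; simpl; ring. }
  assert (E2 : forall x, RInt (fun y => Re (h (x, y))) c d =
     RInt (fun y => (Re p + Re q * x) + (- Im q) * y) c d).
  { intros x; apply RInt_ext; intros y _; rewrite H; unfold Re, Im; simpl; ring. }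
  rewrite !E1, !E2, !RInt_affine. field.
Qed.

Lemma im_contour_plus (f g h : C -> C) (a b c d : R) :
  a <= b -> c <= d ->
  ccont_rect f a b c d -> ccont_rect g a b c d ->
  (forall z, h z = (f z + g z)%C) ->
  im_contour h a b c d = im_contour f a b c d + im_contour g a b c d.
Proof.
  intros Hab Hcd Hf Hg H; unfold im_contour.
  assert (E1 : forall y, c <= y <= d -> RInt (fun x => Im (h (x, y))) a b =
     RInt (fun x => Im (f (x, y))) a b + RInt (fun x => Im (g (x, y))) a b).
  { intros y Hy. rewrite <- (RInt_plus (V := R_CompleteNormedModule)).
    - apply RInt_ext; intros x _; rewrite H; reflexivity.
    - eapply ex_RInt_im_horizontal; eauto; lra.
    - eapply ex_RInt_im_horizontal; eauto; lra. }
  assert (E2 : forall x, a <= x <= b -> RInt (fun y => Re (h (x, y))) c d =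
     RInt (fun y => Re (f (x, y))) c d + RInt (fun y => Re (g (x, y))) c d).
  { intros x Hx. rewrite <- (RInt_plus (V := R_CompleteNormedModule)).
    - apply RInt_ext; intros y _; rewrite H; reflexivity.
    - eapply ex_RInt_re_vertical; eauto; lra.
    - eapply ex_RInt_re_vertical; eauto; lra. }
  rewrite !E1, !E2 by lra. ring.
Qed.

Lemma im_contour_bound (h : C -> C) (a b c d M : R) :
  a <= b -> c <= d -> ccont_rect h a b c d ->
  (forall x y, a <= x <= b -> c <= y <= d -> Cmod (h (x, y)) <= M) ->
  Rabs (im_contour h a b c d) <= 2 * ((b - a) + (d - c)) * M.
Proof.
  intros Hab Hcd Hh HM; unfold im_contour.
  assert (E1 : forall y, c <= y <= d ->
     Rabs (RInt (fun x => Im (h (x, y))) a b) <= (b - a) * M).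
  { intros y Hy; apply abs_RInt_le_const; auto.
    - eapply ex_RInt_im_horizontal; eauto; lra.
    - intros x Hx; eapply Rle_trans; [apply Cmod_im_le|now apply HM]. }
  assert (E2 : forall x, a <= x <= b ->
     Rabs (RInt (fun y => Re (h (x, y))) c d) <= (d - c) * M).
  { intros x Hx; apply abs_RInt_le_const; auto.
    - eapply ex_RInt_re_vertical; eauto; lra.
    - intros y Hy; eapply Rle_trans; [apply re_le_Cmod|now apply HM]. }
  assert (A1 := E1 c ltac:(lra)). assert (A2 := E1 d ltac:(lra)).
  assert (A3 := E2 a ltac:(lra)). assert (A4 := E2 b ltac:(lra)).
  apply Rabs_le_between in A1. apply Rabs_le_between in A2.
  apply Rabs_le_between in A3. apply Rabs_le_between in A4.
  apply Rabs_le_between. lra.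
Qed.

(** Let s be width plus height. If the integral is nonzero, some quarter inherits |integral| > k
    s^2, since s halves and the integrals add up. Near the limit point [h] is affine up to an error
    (k/2) s; the affine part integrates to 0 and the error to at most 2 s (k/2) s = k s^2, a
    contradiction. *)
Lemma goursat_le (h : C -> C) (a b c d : R) :
  a <= b -> c <= d ->
  (forall x y, a <= x <= b -> c <= y <= d -> exists l, cderiv h (x, y) l) ->
  im_contour h a b c d = 0.
Proof.
  intros Hab Hcd Hd.
  assert (Hc : ccont_rect h a b c d).
  { intros x y Hx Hy; destruct (Hd x y Hx Hy) as [l Hl]; eapply cderiv_ccont; eauto. }
  apply NNPP; intros Hne. apply Rabs_pos_lt in Hne.
  set (I := Rabs (im_contour h a b c d)) in *.
  set (S := (b - a) + (d - c)).
  (* The added 1 makes k S^2 < I strict and covers a degenerate rectangle. *)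
  set (k := I / (S * S + 1)).
  assert (Hk : 0 < k) by (apply Rdiv_lt_0_compat; [auto|nra]).
  set (P := fun a' b' c' d' => a <= a' /\ b' <= b /\ c <= c' /\ d' <= d /\
    k * ((b' - a' + (d' - c')) * (b' - a' + (d' - c'))) < Rabs (im_contour h a' b' c' d')).
  destruct (rectangle_bisection P a b c d) as [x [y [Hx [Hy K]]]]; auto.
  - clear - Hc. intros a' b' c' d' H1 H2 [P1 [P2 [P3 [P4 P5]]]].
    set (m := (a' + b') / 2). set (n := (c' + d') / 2).
    rewrite (im_contour_quarters h a' m b' c' n d') in P5;
      [|unfold m; lra|unfold n; lra
       |apply (ccont_rect_sub h a b c d); auto].
    set (s := b' - a' + (d' - c')) in *.
    assert (Habs : forall x1 x2 x3 x4, k * (s * s) < Rabs (x1 + x2 + x3 + x4) ->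
       k * (s / 2 * (s / 2)) < Rabs x1 \/ k * (s / 2 * (s / 2)) < Rabs x2 \/
       k * (s / 2 * (s / 2)) < Rabs x3 \/ k * (s / 2 * (s / 2)) < Rabs x4).
    { intros x1 x2 x3 x4 H.
      generalize (Rabs_triang (x1 + x2 + x3) x4) (Rabs_triang (x1 + x2) x3) (Rabs_triang x1 x2).
      intros.
      destruct (Rlt_dec (k * (s / 2 * (s / 2))) (Rabs x1)); auto.
      destruct (Rlt_dec (k * (s / 2 * (s / 2))) (Rabs x2)); auto.
      destruct (Rlt_dec (k * (s / 2 * (s / 2))) (Rabs x3)); auto.
      destruct (Rlt_dec (k * (s / 2 * (s / 2))) (Rabs x4)); auto.
      exfalso. replace (k * (s * s)) with (4 * (k * (s / 2 * (s / 2)))) in H by field. lra. }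
    destruct (Habs _ _ _ _ P5) as [Q|[Q|[Q|Q]]];
      [exists a', m, c', n|exists m, b', c', n|exists a', m, n, d'|exists m, b', n, d'];
      (split; [unfold half_interval, m; lra|split; [unfold half_interval, n; lra|]]);
      (unfold P; split; [unfold m; lra|split; [unfold m; lra|split; [unfold n; lra|split; [unfold n; lra|]]]]);
      match goal with |- k * (?u * ?u) < _ => replace u with (s / 2) by (unfold s, m, n; field) end; exact Q.
  - unfold P; repeat split; try lra.
    fold S. fold I.
    apply Rlt_le_trans with (k * (S * S + 1)); [nra|].
    right; unfold k; field; nra.
  - destruct (Hd x y Hx Hy) as [l Hl].
    destruct (cderiv_bound h (x, y) l (k / 2) Hl) as [delta [D1 D2]]; [lra|].
    destruct (K (delta / 2)) as [a' [b' [c' [d' [B1 [B2 [B3 [B4 [B5 [B6 [B7 [B8 [B9 [B10 B11]]]]]]]]]]]]]]; [lra|].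
    set (s := b' - a' + (d' - c')) in *.
    set (z0 := (x, y) : C).
    set (e := fun z => (h z + (- h z0 + - l * (z + - z0)))%C).
    assert (He : ccont_rect e a' b' c' d').
    { intros u v Hu Hv. unfold e. apply ccont_plus; [apply Hc; lra|].
      apply ccont_plus; [apply ccont_const|].
      apply ccont_mult; [apply ccont_const|].
      apply ccont_plus; [apply ccont_id|apply ccont_const]. }
    assert (Hb : Rabs (im_contour e a' b' c' d') <= 2 * s * (k / 2 * s)).
    { apply im_contour_bound; auto; try lra.
      intros u v Hu Hv.
      assert (Hm : Cmod ((u, v) - z0) <= s).
      { eapply Rle_trans; [apply Cmod_le_abs|]. unfold z0, Re, Im; simpl.
        apply Rplus_le_compat; apply Rabs_le_between; lra. }
      eapply Rle_trans; [|apply Rmult_le_compat_l; [lra|exact Hm]].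
      replace (e (u, v)) with (h (u, v) - h z0 - l * ((u, v) - z0))%C by (unfold e; ring).
      apply D2. fold z0. unfold s in *; lra. }
    assert (Hs : im_contour h a' b' c' d' = im_contour e a' b' c' d' + 0).
    { rewrite <- (im_contour_affine (fun z => (h z0 - l * z0) + l * z)%C (h z0 - l * z0)%C l a' b' c' d') by reflexivity.
      apply im_contour_plus; try lra; auto.
      - intros u v Hu Hv. apply ccont_plus; [apply ccont_const|].
        apply ccont_mult; [apply ccont_const|apply ccont_id].
      - intros z; unfold e; ring. }
    rewrite Hs, Rplus_0_r in B11. lra.
Qed.

(** Endpoints in any order, as needed for the rectangle between two arbitrary points in the
    construction of a primitive. *)
Lemma goursat (h : C -> C) (a b c d : R) :
  (forall x y, Rmin a b <= x <= Rmax a b -> Rmin c d <= y <= Rmax c d ->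
     exists l, cderiv h (x, y) l) ->
  im_contour h a b c d = 0.
Proof.
  intros Hd.
  assert (Hc : forall x y, Rmin a b <= x <= Rmax a b -> Rmin c d <= y <= Rmax c d ->
     ccont h (x, y)).
  { intros x y Hx Hy; destruct (Hd x y Hx Hy) as [l Hl]; eapply cderiv_ccont; eauto. }
  assert (Hmin : Rmin a b <= a <= Rmax a b /\ Rmin a b <= b <= Rmax a b /\
     Rmin c d <= c <= Rmax c d /\ Rmin c d <= d <= Rmax c d).
  { generalize (Rmin_l a b) (Rmin_r a b) (Rmax_l a b) (Rmax_r a b)
      (Rmin_l c d) (Rmin_r c d) (Rmax_l c d) (Rmax_r c d); intuition. }
  assert (E1 : forall y, Rmin c d <= y <= Rmax c d ->
     RInt (fun x => Im (h (x, y))) b a = - RInt (fun x => Im (h (x, y))) a b).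
  { intros y Hy; symmetry; apply (opp_RInt_swap (V := R_CompleteNormedModule)).
    apply (ex_RInt_continuous (V := R_CompleteNormedModule)).
    intros x Hx; apply ccont_im_horizontal; auto. }
  assert (E2 : forall x, Rmin a b <= x <= Rmax a b ->
     RInt (fun y => Re (h (x, y))) d c = - RInt (fun y => Re (h (x, y))) c d).
  { intros x Hx; symmetry; apply (opp_RInt_swap (V := R_CompleteNormedModule)).
    apply (ex_RInt_continuous (V := R_CompleteNormedModule)).
    intros y Hy; apply ccont_re_vertical; auto. }
  assert (H0 : im_contour h (Rmin a b) (Rmax a b) (Rmin c d) (Rmax c d) = 0).
  { apply goursat_le; auto; eapply Rle_trans; apply Hmin. }
  revert H0; unfold im_contour.
  assert (B1 : Rmin a b = a /\ Rmax a b = b \/ Rmin a b = b /\ Rmax a b = a).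
  { unfold Rmin, Rmax; destruct (Rle_dec a b); auto. }
  assert (B2 : Rmin c d = c /\ Rmax c d = d \/ Rmin c d = d /\ Rmax c d = c).
  { unfold Rmin, Rmax; destruct (Rle_dec c d); auto. }
  assert (F1 := E1 c (proj1 (proj2 (proj2 Hmin)))).
  assert (F2 := E1 d (proj2 (proj2 (proj2 Hmin)))).
  assert (F3 := E2 a (proj1 Hmin)). assert (F4 := E2 b (proj1 (proj2 Hmin))).
  destruct B1 as [[-> ->]|[-> ->]], B2 as [[-> ->]|[-> ->]];
    rewrite ?F1, ?F2, ?F3, ?F4; lra.
Qed.

(** * Primitives and the exponential *)

Lemma RInt_near_const (f : R -> R) (a b c eps : R) :
  (forall t, Rmin a b <= t <= Rmax a b -> continuous f t /\ Rabs (f t - c) <= eps) ->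
  Rabs (RInt f a b - c * (b - a)) <= eps * Rabs (b - a).
Proof.
  intros H.
  assert (He : ex_RInt f a b)
    by (apply (ex_RInt_continuous (V := R_CompleteNormedModule)); apply H).
  assert (Hle : forall u v, u <= v -> ex_RInt f u v ->
    (forall t, u <= t <= v -> Rabs (f t - c) <= eps) ->
    Rabs (RInt f u v - c * (v - u)) <= eps * (v - u)).
  { intros u v Huv Hi Hb.
    assert (E : RInt f u v - c * (v - u) = RInt (fun t => f t - c) u v).
    { rewrite (RInt_minus (V := R_CompleteNormedModule) f (fun _ => c)); auto.
      - rewrite RInt_const. unfold minus, plus, opp, scal; simpl; unfold mult; simpl; ring.
      - apply ex_RInt_const. }
    rewrite E, Rmult_comm. apply abs_RInt_le_const; auto.
    apply (ex_RInt_minus (V := R_CompleteNormedModule) f (fun _ => c)); auto.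
    apply ex_RInt_const. }
  unfold Rmin, Rmax in H; destruct (Rle_dec a b) as [L|L].
  - rewrite (Rabs_pos_eq (b - a)) by lra. apply Hle; auto. apply H.
  - rewrite <- (opp_RInt_swap (V := R_CompleteNormedModule) f b a)
      by now apply ex_RInt_swap.
    replace (opp (RInt f b a) - c * (b - a)) with (- (RInt f b a - c * (a - b)))
      by (unfold opp; simpl; ring).
    rewrite Rabs_Ropp, (Rabs_left1 (b - a)) by lra.
    replace (- (b - a)) with (a - b) by ring.
    apply Hle; [lra|now apply ex_RInt_swap|apply H].
Qed.

Definition holo_disk (G : C -> C) : Prop :=
  forall z, Cmod z < 1 -> exists l, cderiv G z l.

Lemma holo_disk_ccont (G : C -> C) (z : C) : holo_disk G -> Cmod z < 1 -> ccont G z.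
Proof.
  intros H Hz; destruct (H z Hz) as [l Hl]; eapply cderiv_ccont; eauto.
Qed.

(** Imaginary part of the integral of G from 0 to z along the real axis and then vertically. *)
Definition im_primitive (G : C -> C) (z : C) : R :=
  RInt (fun t => Im (G (t, 0))) 0 (Re z) + RInt (fun t => Re (G (Re z, t))) 0 (Im z).

Lemma between_sqr (a t : R) : Rmin 0 a <= t <= Rmax 0 a -> t * t <= a * a.
Proof.
  unfold Rmin, Rmax; destruct (Rle_dec 0 a); intros; nra.
Qed.

Lemma between_abs (a b t : R) : Rmin a b <= t <= Rmax a b -> Rabs (t - a) <= Rabs (b - a).
Proof.
  unfold Rmin, Rmax; destruct (Rle_dec a b); intros;
    [rewrite !Rabs_pos_eq|rewrite !Rabs_left1]; lra.
Qed.

(** Goursat moves the horizontal piece between x and x1 from height 0 up to height y. What remains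
    of the difference is the integral along two short segments, from z to (x1, y) and on to w, where
    [G] is within eps/2 of [G z]. *)
Lemma im_primitive_diff (G : C -> C) (z : C) (eps : R) :
  holo_disk G -> Cmod z < 1 -> 0 < eps ->
  exists delta, 0 < delta /\ forall w, Cmod (w - z) < delta ->
    Rabs (im_primitive G w - im_primitive G z - Im (G z * (w - z))%C)
      <= eps * Cmod (w - z).
Proof.
  intros HG Hz Heps.
  destruct (holo_disk_ccont G z HG Hz (eps / 2)) as [d [Hd K]]; [lra|].
  exists (Rmin (d / 2) ((1 - Cmod z) / 2)); split; [apply Rmin_glb_lt; lra|].
  intros w Hw.
  assert (W1 := Rlt_le_trans _ _ _ Hw (Rmin_l _ _)).
  assert (W2 := Rlt_le_trans _ _ _ Hw (Rmin_r _ _)). clear Hw.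
  assert (V1 := re_le_Cmod (w - z)%C). assert (V2 := Cmod_im_le (w - z)%C).
  set (x := Re z) in *. set (y := Im z) in *. set (x1 := Re w). set (y1 := Im w).
  assert (Ez : z = (x, y)) by (apply C_eq; reflexivity).
  assert (Ew : w = (x1, y1)) by (apply C_eq; reflexivity).
  replace (Re (w - z)%C) with (x1 - x) in V1 by (rewrite Ez, Ew; reflexivity).
  replace (Im (w - z)%C) with (y1 - y) in V2 by (rewrite Ez, Ew; reflexivity).
  assert (Hclose : forall u v, Rabs (u - x) <= Rabs (x1 - x) ->
     Rabs (v - y) <= Rabs (y1 - y) -> Cmod ((u, v) - z) < d /\ Cmod (u, v) < 1).
  { intros u v Hu Hv.
    assert (Hm : Cmod ((u, v) - z) <= 2 * Cmod (w - z)).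
    { eapply Rle_trans; [apply Cmod_le_abs|].
      rewrite Ez; unfold Re, Im; simpl. fold (u - x) (v - y). rewrite <- Ez. lra. }
    generalize (Cmod_triangle_rev (u, v) z). lra. }
  assert (Z1 : forall b, Rabs (b - b) = 0) by (intros; rewrite Rminus_diag; apply Rabs_R0).
  assert (P1 := Rabs_pos (x1 - x)). assert (P2 := Rabs_pos (y1 - y)).
  (* Moving vertically towards the real axis decreases the modulus, so the whole rectangle stays in
     the disk. *)
  assert (Hcol : forall u v, Rabs (u - x) <= Rabs (x1 - x) ->
     Rmin 0 y <= v <= Rmax 0 y -> Cmod (u, v) < 1).
  { intros u v Hu Hv.
    destruct (Hclose u y Hu) as [_ Q]; [rewrite Z1; lra|].
    apply Cmod_lt_sqr in Q; [|lra]. apply Cmod_lt_sqr; [lra|].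
    apply between_sqr in Hv. unfold Re, Im in *; simpl in *; lra. }
  assert (Hrow : forall u, Rabs (u - x) <= Rabs (x1 - x) \/ Rmin 0 x <= u <= Rmax 0 x -> Cmod (u, 0) < 1).
  { intros u [Hu|Hu].
    - apply Hcol; auto. unfold Rmin, Rmax; destruct (Rle_dec 0 y); lra.
    - apply between_sqr in Hu. apply Cmod_lt_sqr in Hz; [|lra]. fold x y in Hz.
      apply Cmod_lt_sqr; [lra|]. unfold Re, Im; simpl. nra. }
  assert (C1 : RInt (fun t => Im (G (t, 0))) 0 x + RInt (fun t => Im (G (t, 0))) x x1
     = RInt (fun t => Im (G (t, 0))) 0 x1).
  { apply (RInt_Chasles (V := R_CompleteNormedModule));
      apply (ex_RInt_continuous (V := R_CompleteNormedModule)); intros t Ht;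
      apply ccont_im_horizontal, holo_disk_ccont; auto.
    apply Hrow; left; now apply between_abs. }
  assert (C2 : RInt (fun t => Re (G (x1, t))) 0 y + RInt (fun t => Re (G (x1, t))) y y1
     = RInt (fun t => Re (G (x1, t))) 0 y1).
  { apply (RInt_Chasles (V := R_CompleteNormedModule));
      apply (ex_RInt_continuous (V := R_CompleteNormedModule)); intros t Ht;
      apply ccont_re_vertical, holo_disk_ccont; auto.
    - apply Hcol; auto; lra.
    - apply Hclose; [lra|now apply between_abs]. }
  assert (HGo : im_contour G x x1 0 y = 0).
  { apply goursat; intros u v Hu Hv. apply HG, Hcol; auto. now apply between_abs. }
  unfold im_contour in HGo.
  assert (N1 : Rabs (RInt (fun t => Im (G (t, y))) x x1 - Im (G z) * (x1 - x))
     <= eps / 2 * Rabs (x1 - x)).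
  { apply RInt_near_const. intros t Ht. apply between_abs in Ht.
    destruct (Hclose t y Ht) as [Q1 Q2]; [rewrite Z1; lra|]. split.
    - apply ccont_im_horizontal, holo_disk_ccont; auto.
    - left; eapply Rle_lt_trans; [|apply (K _ Q1)].
      exact (Cmod_im_le (G (t, y) - G z)%C). }
  assert (N2 : Rabs (RInt (fun t => Re (G (x1, t))) y y1 - Re (G z) * (y1 - y))
     <= eps / 2 * Rabs (y1 - y)).
  { apply RInt_near_const. intros t Ht. apply between_abs in Ht.
    destruct (Hclose x1 t) as [Q1 Q2]; [lra|auto|]. split.
    - apply ccont_re_vertical, holo_disk_ccont; auto.
    - left; eapply Rle_lt_trans; [|apply (K _ Q1)].
      exact (re_le_Cmod (G (x1, t) - G z)%C). }
  assert (Hprod : Im (G z * (w - z))%C = Im (G z) * (x1 - x) + Re (G z) * (y1 - y)).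
  { rewrite Ez, Ew; unfold Re, Im; simpl; ring. }
  rewrite Hprod. unfold im_primitive. fold x y x1 y1.
  apply Rabs_le_between in N1. apply Rabs_le_between in N2.
  assert (M1 : eps / 2 * Rabs (x1 - x) <= eps / 2 * Cmod (w - z)) by (apply Rmult_le_compat_l; lra).
  assert (M2 : eps / 2 * Rabs (y1 - y) <= eps / 2 * Cmod (w - z)) by (apply Rmult_le_compat_l; lra).
  apply Rabs_le_between. rewrite <- C1, <- C2. lra.
Qed.

Lemma holo_disk_primitive (G : C -> C) :
  holo_disk G -> exists F, F (RtoC 0) = RtoC 0 /\
    forall z, Cmod z < 1 -> cderiv F z (G z).
Proof.
  intros HG.
  set (G' := fun z => (Ci * G z)%C).
  assert (HG' : holo_disk G').
  { intros z Hz. destruct (HG z Hz) as [l Hl]. exists (Ci * l)%C. now apply cderiv_scal. }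
  (* Re F = Im (i F), so the real part comes from the integral of i G. *)
  exists (fun z => (im_primitive G' z, im_primitive G z)); split.
  - unfold im_primitive, Re, Im; simpl. rewrite !RInt_point.
    unfold RtoC, zero; simpl; f_equal; ring.
  - intros z Hz. apply cderiv_of_bound. intros eps Heps.
    destruct (im_primitive_diff G z (eps / 2) HG Hz) as [d1 [H1 K1]]; [lra|].
    destruct (im_primitive_diff G' z (eps / 2) HG' Hz) as [d2 [H2 K2]]; [lra|].
    exists (Rmin d1 d2); split; [now apply Rmin_glb_lt|]. intros w Hw.
    specialize (K1 w (Rlt_le_trans _ _ _ Hw (Rmin_l _ _))).
    specialize (K2 w (Rlt_le_trans _ _ _ Hw (Rmin_r _ _))).
    eapply Rle_trans; [apply Cmod_le_abs|].
    replace (eps * Cmod (w - z)) with (eps / 2 * Cmod (w - z) + eps / 2 * Cmod (w - z)) by field.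
    apply Rplus_le_compat.
    + eapply Rle_trans; [right|exact K2]. f_equal. unfold G'.
      destruct (G z) as [g1 g2], w as [w1 w2], z as [z1 z2].
      unfold Re, Im; simpl; ring.
    + eapply Rle_trans; [right|exact K1]. f_equal.
Qed.

(** * The complex exponential *)

Definition cexp (z : C) : C := (exp (Re z) * cos (Im z), exp (Re z) * sin (Im z)).

Lemma cexp_plus (z w : C) : cexp (z + w) = (cexp z * cexp w)%C.
Proof.
  destruct z as [x y], w as [u v]; unfold cexp; apply C_eq; unfold Re, Im; simpl;
    rewrite exp_plus, ?cos_plus, ?sin_plus; ring.
Qed.

Lemma cexp_0 : cexp (RtoC 0) = RtoC 1.
Proof.
  unfold cexp, RtoC, Re, Im; simpl; rewrite exp_0, cos_0, sin_0; f_equal; ring.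
Qed.

Lemma Cmod_cexp (z : C) : Cmod (cexp z) = exp (Re z).
Proof.
  unfold Cmod, cexp; cbn [fst snd].
  replace ((exp (Re z) * cos (Im z)) ^ 2 + (exp (Re z) * sin (Im z)) ^ 2)
    with (Rsqr (exp (Re z)) * (Rsqr (sin (Im z)) + Rsqr (cos (Im z)))) by (unfold Rsqr; ring).
  rewrite sin2_cos2, Rmult_1_r. apply sqrt_Rsqr; left; apply exp_pos.
Qed.

Lemma cexp_neq_0 (z : C) : cexp z <> RtoC 0.
Proof.
  apply Cmod_gt_0; rewrite Cmod_cexp; apply exp_pos.
Qed.

Lemma derivable_bound (f : R -> R) (l eps : R) :
  derivable_pt_lim f 0 l -> 0 < eps -> exists delta, 0 < delta /\
    forall h, Rabs h < delta -> Rabs (f h - f 0 - l * h) <= eps * Rabs h.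
Proof.
  intros H Heps. destruct (H eps Heps) as [[d Hd] K]; simpl in K.
  exists d; split; auto. intros h Hh.
  destruct (Req_dec h 0) as [->|Hne].
  - replace (f 0 - f 0 - l * 0) with 0 by ring. rewrite Rabs_R0; lra.
  - specialize (K h Hne Hh). rewrite Rplus_0_l in K.
    replace (f h - f 0 - l * h) with (((f h - f 0) / h - l) * h) by (field; auto).
    rewrite Rabs_mult. apply Rmult_le_compat_r; [apply Rabs_pos|lra].
Qed.

Lemma cderiv_cexp_0 : cderiv cexp (RtoC 0) (RtoC 1).
Proof.
  apply cderiv_of_bound; intros eps Heps.
  (* The errors of the two components below add up to at most 9 eta |w|; eta <= 1 serves to bound
     exp by 3. *)
  set (eta := Rmin 1 (eps / 12)).
  assert (Heta : 0 < eta) by (apply Rmin_glb_lt; lra).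
  assert (E1 := Rmin_l 1 (eps / 12)). assert (E2 := Rmin_r 1 (eps / 12)). fold eta in E1, E2.
  destruct (derivable_bound exp 1 eta) as [d1 [D1 K1]]; auto.
  { rewrite <- exp_0. apply derivable_pt_lim_exp. }
  destruct (derivable_bound cos 0 eta) as [d2 [D2 K2]]; auto.
  { generalize (derivable_pt_lim_cos 0); rewrite sin_0, Ropp_0; auto. }
  destruct (derivable_bound sin 1 eta) as [d3 [D3 K3]]; auto.
  { rewrite <- cos_0. apply derivable_pt_lim_sin. }
  exists (Rmin eta (Rmin d1 (Rmin d2 d3))); split; [repeat apply Rmin_glb_lt; lra|].
  intros w. replace (w - RtoC 0)%C with w by ring. intros Hw.
  assert (Hw0 := Rlt_le_trans _ _ _ Hw (Rmin_l _ _)).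
  assert (Hw' := Rlt_le_trans _ _ _ Hw (Rmin_r _ _)).
  assert (Hw1 := Rlt_le_trans _ _ _ Hw' (Rmin_l _ _)).
  assert (Hw'' := Rlt_le_trans _ _ _ Hw' (Rmin_r _ _)).
  assert (Hw2 := Rlt_le_trans _ _ _ Hw'' (Rmin_l _ _)).
  assert (Hw3 := Rlt_le_trans _ _ _ Hw'' (Rmin_r _ _)). clear Hw Hw' Hw''.
  rewrite cexp_0.
  assert (V1 := re_le_Cmod w). assert (V2 := Cmod_im_le w).
  set (a := Re w) in *. set (b := Im w) in *. set (m := Cmod w) in *.
  specialize (K1 a ltac:(lra)). specialize (K2 b ltac:(lra)). specialize (K3 b ltac:(lra)).
  rewrite exp_0 in K1. rewrite cos_0 in K2. rewrite sin_0 in K3.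
  assert (Pa := Rabs_pos a). assert (Pb := Rabs_pos b).
  assert (Me : forall x, 0 <= x <= m -> eta * x <= eta * m) by (intros; apply Rmult_le_compat_l; lra).
  assert (Ma := Me _ (conj Pa V1)). assert (Mb := Me _ (conj Pb V2)).
  assert (Hex : Rabs (exp a - 1) <= 2 * eta).
  { replace (exp a - 1) with (exp a - 1 - 1 * a + a) by ring.
    eapply Rle_trans; [apply Rabs_triang|]. nra. }
  assert (He3 : Rabs (exp a) <= 3).
  { replace (exp a) with (exp a - 1 + 1) by ring.
    eapply Rle_trans; [apply Rabs_triang|]. rewrite Rabs_R1; lra. }
  eapply Rle_trans; [apply Cmod_le_abs|].
  replace (Re (cexp w - RtoC 1 - RtoC 1 * w)%C)
    with (exp a * (cos b - 1 - 0 * b) + (exp a - 1 - 1 * a))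
    by (unfold cexp, a, b, Re, Im; simpl; ring).
  replace (Im (cexp w - RtoC 1 - RtoC 1 * w)%C)
    with (exp a * (sin b - 0 - 1 * b) + (exp a - 1) * b)
    by (unfold cexp, a, b, Re, Im; simpl; ring).
  assert (T1 := Rabs_triang (exp a * (cos b - 1 - 0 * b)) (exp a - 1 - 1 * a)).
  assert (T2 := Rabs_triang (exp a * (sin b - 0 - 1 * b)) ((exp a - 1) * b)).
  rewrite Rabs_mult in T1. rewrite !Rabs_mult in T2.
  assert (Q1 : Rabs (exp a) * Rabs (cos b - 1 - 0 * b) <= 3 * (eta * m))
    by (apply Rmult_le_compat; try apply Rabs_pos; lra).
  assert (Q2 : Rabs (exp a) * Rabs (sin b - 0 - 1 * b) <= 3 * (eta * m))
    by (apply Rmult_le_compat; try apply Rabs_pos; lra).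
  assert (Q3 : Rabs (exp a - 1) * Rabs b <= 2 * eta * m)
    by (apply Rmult_le_compat; try apply Rabs_pos; lra).
  assert (eta * m <= eps / 12 * m) by (apply Rmult_le_compat_r; [unfold m; apply Cmod_ge_0|lra]).
  assert (0 <= eps * m) by (apply Rmult_le_pos; [lra|unfold m; apply Cmod_ge_0]).
  lra.
Qed.

Lemma cderiv_cexp (z : C) : cderiv cexp z (cexp z).
Proof.
  apply (cderiv_ext_loc (fun w => cexp z * cexp (w + - z))%C _ _ _ 1); [lra| |].
  - intros w _. rewrite <- cexp_plus. f_equal; ring.
  - eapply cderiv_eq.
    + apply cderiv_scal. apply (cderiv_comp cexp (fun w => w + - z)%C).
      * replace (z + - z)%C with (RtoC 0) by ring. apply cderiv_cexp_0.
      * apply cderiv_plus; [apply cderiv_id|apply cderiv_const].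
    + ring.
Qed.

(** * Mean values and the Schwarz lemma *)

Lemma Req_of_close (x y K : R) :
  0 < K -> (forall eps, 0 < eps -> Rabs (x - y) <= eps * K) -> x = y.
Proof.
  intros HK H. apply NNPP; intros Hne.
  assert (Hp : 0 < Rabs (x - y)) by (apply Rabs_pos_lt; lra).
  specialize (H (Rabs (x - y) / (2 * K)) ltac:(apply Rdiv_lt_0_compat; lra)).
  replace (Rabs (x - y) / (2 * K) * K) with (Rabs (x - y) / 2) in H by (field; lra). lra.
Qed.

Section MeanValue.

Variables (g : C -> C) (p : C) (R0 : R).
Hypothesis Hg : forall z, z <> p -> Cmod (z - p) < R0 -> exists l, cderiv g z l.
Hypothesis Hp : ccont g p.

(** Logarithmic coordinate about [p]: the line Re z = ln r becomes the circle of radius r. Since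
    [cexp] omits 0, [h] is differentiable wherever exp (Re z) < R0, although [g] is only continuous
    at [p]. *)
Let h (z : C) : C := g (p + cexp z)%C.

Lemma polar_sub (z : C) : Cmod (p + cexp z - p) = exp (Re z).
Proof.
  rewrite <- Cmod_cexp; f_equal; ring.
Qed.

Lemma cderiv_polar (z : C) : exp (Re z) < R0 -> exists l, cderiv h z l.
Proof.
  intros Hz. destruct (Hg (p + cexp z)%C) as [l Hl].
  - intros E. apply (cexp_neq_0 z).
    replace (cexp z) with (p + cexp z - p)%C by ring. rewrite E; ring.
  - now rewrite polar_sub.
  - exists (l * (RtoC 0 + cexp z))%C. apply (cderiv_comp g); auto.
    apply cderiv_plus; [apply cderiv_const|apply cderiv_cexp].
Qed.

Lemma continuous_polar (s t : R) : exp s < R0 -> continuous (fun y => Re (h (s, y))) t.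
Proof.
  intros Hs. destruct (cderiv_polar (s, t) Hs) as [l Hl].
  apply ccont_re_vertical. eapply cderiv_ccont; eauto.
Qed.

(* Goursat in the logarithmic coordinate: the vertical sides of the rectangle are circles, and the horizontal ones cancel by periodicity. *)
Lemma circle_mean_indep (s0 s1 : R) : s0 <= s1 -> exp s1 < R0 ->
  RInt (fun t => Re (h (s0, t))) 0 (2 * PI) = RInt (fun t => Re (h (s1, t))) 0 (2 * PI).
Proof.
  intros Hs Hs1.
  assert (HG : im_contour h s0 s1 0 (2 * PI) = 0).
  { apply goursat_le; auto; [generalize PI_RGT_0; lra|].
    intros x y Hx _; apply cderiv_polar. unfold Re; simpl.
    eapply Rle_lt_trans; [|exact Hs1].
    destruct (proj2 Hx) as [L| ->]; [left; now apply exp_increasing|lra]. }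
  unfold im_contour in HG.
  assert (E : RInt (fun x => Im (h (x, 2 * PI))) s0 s1 = RInt (fun x => Im (h (x, 0))) s0 s1).
  { apply RInt_ext; intros x _. unfold h, cexp, Re, Im; simpl.
    rewrite cos_2PI, sin_2PI, cos_0, sin_0; reflexivity. }
  lra.
Qed.

(** The integral does not depend on the radius, and on a circle small enough continuity at [p] keeps
    the integrand within eps of Re (g p). *)
Lemma mean_value (r : R) : 0 < r < R0 ->
  RInt (fun t => Re (g (p + cexp (ln r, t)))%C) 0 (2 * PI) = Re (g p) * (2 * PI).
Proof.
  intros Hr. assert (HPI := PI_RGT_0).
  apply (Req_of_close _ _ (2 * PI)); [lra|]. intros eps Heps.
  destruct (Hp eps Heps) as [d [Hd K]].
  set (s0 := Rmin (ln r) (ln (d / 2))).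
  change (fun t => Re (g (p + cexp (ln r, t)))%C) with (fun t => Re (h (ln r, t))).
  rewrite <- (circle_mean_indep s0 (ln r)); [|apply Rmin_l|rewrite exp_ln; lra].
  assert (Hle : forall u, s0 <= ln u -> 0 < u -> exp s0 <= u).
  { intros u Hu U. rewrite <- (exp_ln u U).
    destruct Hu as [L| ->]; [left; now apply exp_increasing|lra]. }
  assert (Hs1 : exp s0 <= r) by (apply Hle; [apply Rmin_l|lra]).
  assert (Hs2 : exp s0 <= d / 2) by (apply Hle; [apply Rmin_r|lra]).
  replace (Re (g p) * (2 * PI)) with (Re (g p) * (2 * PI - 0)) by ring.
  replace (eps * (2 * PI)) with (eps * Rabs (2 * PI - 0)) by (rewrite Rabs_pos_eq; lra).
  apply RInt_near_const. intros t _; split.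
  - apply continuous_polar; lra.
  - left; eapply Rle_lt_trans; [|apply (K (p + cexp (s0, t))%C)].
    + exact (re_le_Cmod (h (s0, t) - g p)%C).
    + rewrite polar_sub; unfold Re; simpl; lra.
Qed.

Lemma mean_value_le (r M : R) : 0 < r < R0 ->
  (forall z, Cmod (z - p) = r -> Re (g z) <= M) -> Re (g p) <= M.
Proof.
  intros Hr HM. assert (HPI := PI_RGT_0).
  apply (Rmult_le_reg_r (2 * PI)); [lra|]. rewrite <- (mean_value r Hr).
  replace (M * (2 * PI)) with (RInt (fun _ => M) 0 (2 * PI))
    by (rewrite RInt_const; unfold scal; simpl; unfold mult; simpl; ring).
  apply RInt_le; [lra| |apply ex_RInt_const|].
  - apply (ex_RInt_continuous (V := R_CompleteNormedModule)).
    intros t _; apply continuous_polar; rewrite exp_ln; lra.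
  - intros t _; apply HM. rewrite polar_sub; unfold Re; simpl. apply exp_ln; lra.
Qed.

End MeanValue.

Lemma Cmod_unit_rotation (z : C) : exists c : C, Cmod c = 1 /\ (c * z)%C = RtoC (Cmod z).
Proof.
  destruct (Ceq_dec z (RtoC 0)) as [->|Hz].
  - exists (RtoC 1); split; [apply Cmod_1|rewrite Cmod_0; ring].
  - assert (Hp : 0 < Cmod z) by now apply Cmod_gt_0.
    assert (Hn : RtoC (Cmod z) <> RtoC 0) by (intros E; injection E; lra).
    exists (RtoC (Cmod z) / z)%C; split.
    + rewrite Cmod_div, Cmod_R, Rabs_pos_eq by (auto; lra). field; lra.
    + field; auto.
Qed.

(* Adding eps |z|^2 makes the modulus strictly subharmonic, so that it has no interior maximum at all. *)
Lemma max_principle (g : C -> C) (R0 r M : R) :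
  (forall z, z <> RtoC 0 -> Cmod z < R0 -> exists l, cderiv g z l) ->
  ccont g (RtoC 0) -> 0 < r < R0 ->
  (forall z, Cmod z = r -> Cmod (g z) <= M) ->
  forall z, Cmod z <= r -> Cmod (g z) <= M.
Proof.
  intros Hg H0 Hr HM z0 Hz0. apply Rnot_lt_le; intros Hlt.
  assert (Hcont : forall z, Cmod z < R0 -> ccont g z).
  { intros z Hz. destruct (Ceq_dec z (RtoC 0)) as [->|E]; auto.
    destruct (Hg z E Hz) as [l Hl]. eapply cderiv_ccont; eauto. }
  (* With this choice eps r^2 is half the excess of |g z0| over M, so f stays below f z0 on the
     boundary circle and its maximum is interior. *)
  set (eps := (Cmod (g z0) - M) / (2 * (r * r))).
  assert (Heps : 0 < eps) by (apply Rdiv_lt_0_compat; nra).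
  assert (Hepsr : eps * (r * r) = (Cmod (g z0) - M) / 2) by (unfold eps; field; lra).
  set (f := fun z => Cmod (g z) + eps * (Cmod z * Cmod z)).
  destruct (disk_extreme_value f r) as [p [Hp Hmax]]; [lra| |].
  { intros z Hz e He.
    destruct (Hcont z ltac:(lra) (e / 2)) as [d1 [D1 K1]]; [lra|].
    destruct (ccont_id z (e / (4 * eps * (r + 1)))) as [d2 [D2 K2]].
    { apply Rdiv_lt_0_compat; [lra|]. assert (0 < eps * (r + 1)) by nra. lra. }
    exists (Rmin 1 (Rmin d1 d2)); split; [repeat apply Rmin_glb_lt; lra|].
    intros w Hw.
    assert (Hw1 := Rlt_le_trans _ _ _ Hw (Rmin_l _ _)).
    assert (Hw' := Rlt_le_trans _ _ _ Hw (Rmin_r _ _)).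
    specialize (K1 w (Rlt_le_trans _ _ _ Hw' (Rmin_l _ _))).
    specialize (K2 w (Rlt_le_trans _ _ _ Hw' (Rmin_r _ _))).
    simpl in K2. clear Hw Hw'.
    assert (T1 := Cmod_triangle_rev (g w) (g z)).
    assert (T2 := Cmod_triangle_rev (g z) (g w)). rewrite (Cmod_sub_sym (g z)) in T2.
    assert (T3 := Cmod_triangle_rev w z).
    assert (T4 := Cmod_triangle_rev z w). rewrite (Cmod_sub_sym z) in T4.
    assert (Q : eps * Rabs (Cmod w * Cmod w - Cmod z * Cmod z) <= e / 2).
    { replace (Cmod w * Cmod w - Cmod z * Cmod z)
        with ((Cmod w - Cmod z) * (Cmod w + Cmod z)) by ring.
      rewrite Rabs_mult.
      assert (A1 : Rabs (Cmod w - Cmod z) <= Cmod (w - z)) by (apply Rabs_le_between; lra).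
      assert (A2 : Rabs (Cmod w + Cmod z) <= 2 * (r + 1)).
      { rewrite Rabs_pos_eq; [lra|]. generalize (Cmod_ge_0 w) (Cmod_ge_0 z); lra. }
      assert (A3 : Rabs (Cmod w - Cmod z) * Rabs (Cmod w + Cmod z)
         <= e / (4 * eps * (r + 1)) * (2 * (r + 1)))
        by (apply Rmult_le_compat; try apply Rabs_pos; lra).
      replace (e / (4 * eps * (r + 1)) * (2 * (r + 1))) with (e / 2 / eps) in A3
        by (field; split; lra).
      apply Rle_trans with (eps * (e / 2 / eps)); [apply Rmult_le_compat_l; lra|].
      right; field; lra. }
    set (D := Cmod w * Cmod w - Cmod z * Cmod z) in *.
    assert (Q1 : eps * D <= eps * Rabs D) by (apply Rmult_le_compat_l; [lra|apply Rle_abs]).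
    assert (Q2 : eps * - D <= eps * Rabs D)
      by (rewrite <- Rabs_Ropp; apply Rmult_le_compat_l; [lra|apply Rle_abs]).
    apply Rabs_lt_between. unfold f.
    replace (Cmod (g w) + eps * (Cmod w * Cmod w) - (Cmod (g z) + eps * (Cmod z * Cmod z)))
      with (Cmod (g w) - Cmod (g z) + eps * D) by (unfold D; ring).
    lra. }
  assert (Hf0 : M + eps * (r * r) < f p).
  { apply Rlt_le_trans with (f z0); [|now apply Hmax]. unfold f.
    assert (0 <= eps * (Cmod z0 * Cmod z0)) by (apply Rmult_le_pos; [lra|nra]). lra. }
  destruct Hp as [Hp|Hp].
  2: { unfold f in Hf0. rewrite Hp in Hf0. specialize (HM p Hp). lra. }
  destruct (Cmod_unit_rotation (g p)) as [c [Hc1 Hc2]].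
  assert (Hs : exists s, 0 < s /\ Cmod p + s <= r /\ (p <> RtoC 0 -> s < Cmod p)).
  { destruct (Ceq_dec p (RtoC 0)) as [E|E].
    - exists (r - Cmod p); repeat split; [lra|lra|easy].
    - assert (0 < Cmod p) by now apply Cmod_gt_0.
      exists (Rmin (r - Cmod p) (Cmod p / 2)).
      generalize (Rmin_l (r - Cmod p) (Cmod p / 2)) (Rmin_r (r - Cmod p) (Cmod p / 2)).
      repeat split; [apply Rmin_glb_lt; lra|lra|intros _; lra]. }
  destruct Hs as [s [Hs1 [Hs2 Hs3]]].
  assert (Hexp : forall z, Cmod (z - p) = s -> Cmod z * Cmod z =
     Cmod p * Cmod p + s * s + 2 * Re (Cconj p * (z - p))%C).
  { intros z <-. rewrite !Cmod_sqr. destruct z, p; unfold Re, Im; simpl; ring. }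
  (* On the circle |z - p| = s, |z|^2 is the real part of an affine function of z, so Re k <= f
     there, while [c] rotates g p to |g p| and gives Re (k p) = f p + eps s^2. The mean value bound
     Re (k p) <= f p is then contradictory. *)
  set (k := fun z => (c * g z + RtoC eps * (RtoC (Cmod p * Cmod p + s * s) + (RtoC 2 * Cconj p) * (z + - p)))%C).
  assert (Hk : Re (k p) = f p + eps * (s * s)).
  { unfold k. rewrite Hc2. unfold f, Re, Im; simpl. ring. }
  assert (Hkle : Re (k p) <= f p).
  { assert (Hkc : forall z, ccont (fun z => RtoC eps * (RtoC (Cmod p * Cmod p + s * s) + (RtoC 2 * Cconj p) * (z + - p)))%C z /\
        exists l, cderiv (fun z => RtoC eps * (RtoC (Cmod p * Cmod p + s * s) + (RtoC 2 * Cconj p) * (z + - p)))%C z l).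
    { intros z. assert (Hl : exists l, cderiv (fun z => RtoC eps * (RtoC (Cmod p * Cmod p + s * s) + (RtoC 2 * Cconj p) * (z + - p)))%C z l).
      { eexists. apply cderiv_scal, cderiv_plus; [apply cderiv_const|].
        apply cderiv_scal, cderiv_plus; [apply cderiv_id|apply cderiv_const]. }
      split; auto. destruct Hl as [l Hl]; eapply cderiv_ccont; eauto. }
    (* The exceptional point 0 is either the centre of the disk or outside it. *)
    set (R1 := if Ceq_dec p (RtoC 0) then R0 else Rmin (R0 - Cmod p) (Cmod p)).
    apply (mean_value_le k p R1) with (r := s).
    - intros z Hzp Hz.
      destruct (Hg z) as [l Hl].
      + unfold R1 in Hz. destruct (Ceq_dec p (RtoC 0)) as [E|E].
        * now rewrite <- E.
        * intros ->. assert (B := Rlt_le_trans _ _ _ Hz (Rmin_r _ _)).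
          rewrite Cmod_sub_sym in B. replace (p - RtoC 0)%C with p in B by ring. lra.
      + unfold R1 in Hz. destruct (Ceq_dec p (RtoC 0)) as [E|E].
        * rewrite E in Hz. replace (z - RtoC 0)%C with z in Hz by ring. exact Hz.
        * assert (B := Rlt_le_trans _ _ _ Hz (Rmin_l _ _)).
          generalize (Cmod_triangle_rev z p); lra.
      + destruct (Hkc z) as [_ [l' Hl']]. eexists. apply cderiv_plus; [|exact Hl'].
        apply cderiv_scal; exact Hl.
    - apply ccont_plus; [|apply Hkc]. apply ccont_mult; [apply ccont_const|apply Hcont; lra].
    - split; auto. unfold R1. destruct (Ceq_dec p (RtoC 0)) as [E|E].
      + generalize (Cmod_ge_0 p); lra.
      + apply Rmin_glb_lt; [lra|auto].
    - intros z Hz.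
      assert (Hkz : Re (k z) = Re (c * g z)%C + eps * (Cmod z * Cmod z)).
      { rewrite (Hexp z Hz). unfold k, Re, Im; simpl. ring. }
      rewrite Hkz. apply Rle_trans with (f z).
      + unfold f. apply Rplus_le_compat_r. eapply Rle_trans; [apply Rle_abs|].
        eapply Rle_trans; [apply re_le_Cmod|]. rewrite Cmod_mult, Hc1; lra.
      + apply Hmax. generalize (Cmod_triangle_rev z p); lra. }
  assert (0 < eps * (s * s)) by (apply Rmult_lt_0_compat; [exact Heps|nra]). lra.
Qed.

(** The factor [q] at 0 satisfies w u = q u * u, is continuous at 0 and differentiable elsewhere:
    exactly the setting of [max_principle]. On |u| = r one has |q| <= 1/r, and r tends to 1. *)
Lemma schwarz (w : C -> C) :
  holo_disk w -> w (RtoC 0) = RtoC 0 ->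
  (forall z, Cmod z < 1 -> Cmod (w z) < 1) ->
  forall z, Cmod z < 1 -> Cmod (w z) <= Cmod z.
Proof.
  intros Hw H0 Hb z Hz.
  destruct (Hw (RtoC 0)) as [l [q [Hq [_ He]]]]; [rewrite Cmod_0; lra|].
  assert (Hwq : forall u, w u = (q u * u)%C).
  { intros u; rewrite (He u), H0; ring. }
  assert (Hd : forall u, u <> RtoC 0 -> Cmod u < 1 -> exists l, cderiv q u l).
  { intros u Hu Hu1. destruct (Hw u Hu1) as [m Hm].
    eexists. apply (cderiv_ext_loc (fun v => w v * / v)%C _ _ _ (Cmod u)).
    - now apply Cmod_gt_0.
    - intros v Hv. rewrite Hwq. field. apply Cmod_gt_0.
      generalize (Cmod_triangle_rev u v). rewrite Cmod_sub_sym. lra.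
    - apply cderiv_mult; [exact Hm|]. apply (cderiv_inv (fun v => v)); auto. apply cderiv_id. }
  assert (Hq1 : Cmod (q z) <= 1).
  { apply Rnot_lt_le; intros Hlt.
    assert (Hz0 := Cmod_ge_0 z).
    (* A radius r < 1 with |z| < r and 1/r < |q z|. *)
    set (r := Rmax ((1 + Cmod z) / 2) ((1 + / Cmod (q z)) / 2)).
    assert (Hinv : / Cmod (q z) < 1) by (rewrite <- Rinv_1; apply Rinv_lt_contravar; lra).
    assert (Hr1 : r < 1) by (apply Rmax_lub_lt; lra).
    assert (Hr2 := Rmax_l ((1 + Cmod z) / 2) ((1 + / Cmod (q z)) / 2)).
    assert (Hr3 := Rmax_r ((1 + Cmod z) / 2) ((1 + / Cmod (q z)) / 2)). fold r in Hr2, Hr3.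
    assert (HM : Cmod (q z) <= / r).
    { apply (max_principle q 1 r); auto; [lra| |lra].
      intros u Hu. assert (B := Hb u ltac:(lra)). rewrite Hwq, Cmod_mult, Hu in B.
      left. apply (Rmult_lt_reg_r r); [lra|]. rewrite Rinv_l; lra. }
    assert (/ r < Cmod (q z)).
    { rewrite <- (Rinv_inv (Cmod (q z))). apply Rinv_lt_contravar; [|lra].
      apply Rmult_lt_0_compat; [apply Rinv_0_lt_compat|]; lra. }
    lra. }
  rewrite Hwq, Cmod_mult. generalize (Cmod_ge_0 z) (Cmod_ge_0 (q z)); nra.
Qed.

(** * The nephroid domain *)

(* [Defs.C] and Coquelicot's [C] are convertible, but [ring] and [field] only recognise the latter. *)
Ltac to_Coquelicot_C := match goal with |- @eq _ ?a ?b => change (@eq C a b) end.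

Lemma ccont_Cmod_eps (f : C -> C) (z : C) :
  ccont f z -> forall eps, 0 < eps -> exists delta, 0 < delta /\
    forall w, Cmod (w - z) < delta -> Rabs (- Cmod (f w) - - Cmod (f z)) < eps.
Proof.
  intros H eps Heps. destruct (H eps Heps) as [d [Hd K]].
  exists d; split; auto. intros w Hw. specialize (K w Hw).
  generalize (Cmod_triangle_rev (f w) (f z)) (Cmod_triangle_rev (f z) (f w)).
  rewrite (Cmod_sub_sym (f z)). intros. apply Rabs_lt_between; lra.
Qed.

(* The minimum over the disk of the displacement of a contraction is zero, since applying the contraction once more decreases it. *)
Lemma disk_fixed_point (T : C -> C) (r k : R) :
  0 <= r -> k < 1 -> (forall z, ccont T z) ->
  (forall z, Cmod z <= r -> Cmod (T z) <= r) ->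
  (forall z w, Cmod z <= r -> Cmod w <= r -> Cmod (T z - T w) <= k * Cmod (z - w)) ->
  exists z, Cmod z <= r /\ T z = z.
Proof.
  intros Hr Hk HT Hmaps Hcontr.
  destruct (disk_extreme_value (fun z => - Cmod (T z + - z)) r) as [p [Hp Hmin]]; auto.
  { intros z _. apply (ccont_Cmod_eps (fun z => T z + - z)%C).
    apply ccont_plus; auto. apply ccont_opp, ccont_id. }
  exists p; split; auto.
  specialize (Hmin (T p) (Hmaps p Hp)). cbv beta in Hmin.
  specialize (Hcontr (T p) p (Hmaps p Hp) Hp).
  change (T (T p) + - T p)%C with (T (T p) - T p)%C in Hmin.
  change (T p + - p)%C with (T p - p)%C in Hmin.
  assert (E : (T p - p)%C = RtoC 0).
  { apply Cmod_eq_0. generalize (Cmod_ge_0 (T p - p)); nra. }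
  replace (T p) with (T p - p + p)%C by ring. rewrite E; ring.
Qed.

Lemma phiNe_E (v : C) : phiNe v = (RtoC 1 + v - v * v * v / RtoC 3)%C.
Proof.
  unfold phiNe. rewrite Defs_Cdiv_E.
  change (RtoC 1 + v - v * (v * v) / RtoC 3 = RtoC 1 + v - v * v * v / RtoC 3)%C.
  replace (v * (v * v))%C with (v * v * v)%C by ring; reflexivity.
Qed.

Lemma RtoC_neq_0 (x : R) : x <> 0 -> RtoC x <> RtoC 0.
Proof.
  intros H E; injection E; auto.
Qed.

(* [v] is the fixed point of the contraction [v |-> w + v^3/3]. *)
Lemma in_OmegaNe_disk (w : C) : Cmod w < 2 / 3 -> in_OmegaNe (RtoC 1 + w)%C.
Proof.
  intros Hw. assert (H3 : RtoC 3 <> RtoC 0) by (apply RtoC_neq_0; lra).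
  assert (Hw0 := Cmod_ge_0 w).
  (* For r = 1 - eta, r - r^3/3 = 2/3 - eta^2 + eta^3/3, which is at least 2/3 - eta >= |w|; hence
     the map preserves the disk of radius r. Its contraction constant there is r^2 < 1. *)
  set (eta := Rmin (1 / 2) (2 / 3 - Cmod w)).
  assert (He1 := Rmin_l (1 / 2) (2 / 3 - Cmod w)).
  assert (He2 := Rmin_r (1 / 2) (2 / 3 - Cmod w)). fold eta in He1, He2.
  assert (He0 : 0 < eta) by (apply Rmin_glb_lt; lra).
  set (r := 1 - eta).
  assert (Hrw : Cmod w + r * r * r / 3 <= r).
  { assert (r - r * r * r / 3 = 2 / 3 - eta * eta + eta * eta * eta / 3) by (unfold r; field).
    assert (0 <= eta * eta * eta) by (apply Rmult_le_pos; nra). nra. }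
  destruct (disk_fixed_point (fun v => w + v * v * v * / RtoC 3)%C r (r * r)) as [v [Hv E]].
  - unfold r; lra.
  - unfold r; nra.
  - intros z. apply ccont_plus; [apply ccont_const|].
    repeat apply ccont_mult; try apply ccont_id. apply ccont_const.
  - intros z Hz. eapply Rle_trans; [apply Cmod_triangle|].
    rewrite !Cmod_mult, Cmod_inv, Cmod_R, Rabs_pos_eq by (auto; lra).
    assert (Cmod z * Cmod z * Cmod z <= r * r * r).
    { assert (H := Cmod_ge_0 z).
      apply Rmult_le_compat; try apply Rmult_le_pos; try apply Rmult_le_compat; lra. }
    lra.
  - intros z u Hz Hu.
    replace (w + z * z * z * / RtoC 3 - (w + u * u * u * / RtoC 3))%C
      with ((z - u) * (z * z + z * u + u * u) * / RtoC 3)%C by ring.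
    rewrite !Cmod_mult, Cmod_inv, Cmod_R, Rabs_pos_eq by (auto; lra).
    assert (Cmod (z * z + z * u + u * u) <= 3 * (r * r)).
    { eapply Rle_trans; [apply Cmod_triangle|].
      assert (T := Cmod_triangle (z * z) (z * u)). rewrite !Cmod_mult in *.
      generalize (Cmod_ge_0 z) (Cmod_ge_0 u); intros.
      assert (Cmod z * Cmod z <= r * r) by (apply Rmult_le_compat; lra).
      assert (Cmod z * Cmod u <= r * r) by (apply Rmult_le_compat; lra).
      assert (Cmod u * Cmod u <= r * r) by (apply Rmult_le_compat; lra). lra. }
    generalize (Cmod_ge_0 (z - u)). nra.
  - exists v; split.
    + unfold in_D, in_disk. rewrite Cnorm_E. unfold r in Hv; lra.
    + rewrite phiNe_E.
      assert (E' : (RtoC 1 + (w + v * v * v * / RtoC 3) - v * v * v / RtoC 3)%C = (RtoC 1 + w)%C)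
        by (field; auto).
      rewrite E in E'. symmetry; exact E'.
Qed.

Lemma Cmult_integral (z w : C) : (z * w)%C = RtoC 0 -> z = RtoC 0 \/ w = RtoC 0.
Proof.
  intros H. destruct (Ceq_dec z (RtoC 0)) as [|Hz]; [now left|].
  destruct (Ceq_dec w (RtoC 0)) as [|Hw]; [now right|].
  exfalso; exact (Cmult_neq_0 z w Hz Hw H).
Qed.

Lemma Cminus_eq_0 (z w : C) : (z - w)%C = RtoC 0 -> z = w.
Proof.
  intros H. replace z with (z - w + w)%C by ring. rewrite H; ring.
Qed.

(* For [e = 1] or [-1], [v - v^3/3 - 2e/3 = - (v - e)^2 (v + 2e) / 3]: the cusps of the nephroid. *)
Lemma not_in_OmegaNe_cusp (e : R) :
  e = 1 \/ e = -1 -> ~ in_OmegaNe (RtoC (1 + e * (2 / 3))).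
Proof.
  intros He [v [Hv E]]. unfold in_D, in_disk in Hv. rewrite Cnorm_E in Hv.
  assert (H3 : RtoC 3 <> RtoC 0) by (apply RtoC_neq_0; lra).
  rewrite phiNe_E, RtoC_plus, RtoC_mult, RtoC_div in E by lra.
  assert (Hf : ((v - RtoC e) * ((v - RtoC e) * (v - RtoC (- 2 * e))))%C = RtoC 0).
  { assert (E' : (RtoC 3 * v - v * v * v - RtoC 2 * RtoC e)%C = RtoC 0).
    { replace (RtoC 3 * v - v * v * v - RtoC 2 * RtoC e)%C with
        (RtoC 3 * ((RtoC 1 + v - v * v * v / RtoC 3) - (RtoC 1 + RtoC e * (RtoC 2 / RtoC 3))))%C
        by (field; auto).
      rewrite <- E. ring. }
    transitivity (- (RtoC 3 * v - v * v * v - RtoC 2 * RtoC e))%C; [|rewrite E'; ring].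
    destruct He as [-> | ->]; apply C_eq; destruct v; unfold Re, Im; simpl; ring. }
  assert (Hroot : forall a : R, v = RtoC a -> 1 <= Rabs a -> False).
  { intros a -> Ha. rewrite Cmod_R in Hv. lra. }
  apply Cmult_integral in Hf. destruct Hf as [Hf|Hf].
  2: apply Cmult_integral in Hf; destruct Hf as [Hf|Hf].
  all: apply Cminus_eq_0 in Hf; apply (Hroot _ Hf); destruct He as [-> | ->];
    unfold Rabs; destruct Rcase_abs; lra.
Qed.

(** * Extremal functions and the radius criterion *)

Lemma Qf_0 (f : C -> C) : Qf f (RtoC 0) = RtoC 1.
Proof.
  unfold Qf; simpl. destruct (Req_EM_T 0 0); easy.
Qed.

(** The derivative selected by [epsilon] equals any known one by uniqueness. *)
Lemma Qf_neq_0 (f : C -> C) (z l : C) :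
  z <> RtoC 0 -> cderiv f z l -> Qf f z = (z * l / f z)%C.
Proof.
  intros Hz Hl.
  assert (E : Cderiv f z = l).
  { apply (cderiv_unique f z); auto. apply Cderiv_at_iff.
    unfold Cderiv. apply epsilon_spec. exists l. now apply Cderiv_at_iff. }
  unfold Qf. rewrite E, Defs_Cdiv_E.
  destruct Req_EM_T as [E1|]; [|reflexivity]. destruct Req_EM_T as [E2|]; [|reflexivity].
  exfalso; apply Hz, C_eq; [exact E1|exact E2].
Qed.

Lemma in_D_iff (z : C) : in_D z <-> Cmod z < 1.
Proof.
  unfold in_D, in_disk; rewrite Cnorm_E; reflexivity.
Qed.

Lemma analytic_on_D_iff (f : C -> C) : analytic_on_D f <-> holo_disk f.
Proof.
  unfold analytic_on_D, holo_disk; setoid_rewrite in_D_iff; setoid_rewrite Cderiv_at_iff.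
  reflexivity.
Qed.

(* [f(z) = z exp F(z)] with [F' = G = (phi - 1)/z] is extremal. *)
Lemma Sstar_extremal (phi G : C -> C) :
  holo_disk G -> (forall z, Cmod z < 1 -> phi z = (RtoC 1 + z * G z)%C) ->
  exists f, Sstar phi f /\ forall z, Cmod z < 1 -> Qf f z = phi z.
Proof.
  intros HG Hphi. destruct (holo_disk_primitive G HG) as [F [HF0 HF]].
  set (f := fun z => (z * cexp (F z))%C).
  assert (Hf : forall z, Cmod z < 1 ->
     cderiv f z (RtoC 1 * cexp (F z) + z * (cexp (F z) * G z))%C).
  { intros z Hz. apply (cderiv_mult (fun z => z) (fun z => cexp (F z))); [apply cderiv_id|].
    apply (cderiv_comp cexp); [apply cderiv_cexp|auto]. }
  assert (HQ : forall z, Cmod z < 1 -> Qf f z = phi z).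
  { intros z Hz. rewrite Hphi by auto. destruct (Ceq_dec z (RtoC 0)) as [->|E].
    - rewrite Qf_0. to_Coquelicot_C. ring.
    - rewrite (Qf_neq_0 f z _ E (Hf z Hz)). unfold f. to_Coquelicot_C. field.
      split; auto. apply cexp_neq_0. }
  exists f; split; auto. split.
  - split; [|split].
    + apply analytic_on_D_iff. intros z Hz; eexists; now apply Hf.
    + unfold f. change C0 with (RtoC 0). to_Coquelicot_C. ring.
    + apply Cderiv_at_iff. eapply cderiv_eq.
      * apply Hf. change C0 with (RtoC 0). rewrite Cmod_0; lra.
      * change C0 with (RtoC 0). rewrite HF0, cexp_0. change Defs.C1 with (RtoC 1). to_Coquelicot_C. ring.
  - exists (fun z => z); repeat split; auto.
    + apply analytic_on_D_iff. intros z _; eexists; apply cderiv_id.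
    + intros z Hz; apply HQ. now apply in_D_iff.
Qed.

Lemma Sstar_Qf_subordinate (phi f : C -> C) (z : C) :
  Sstar phi f -> Cmod z < 1 -> exists u, Cmod u <= Cmod z /\ Qf f z = phi u.
Proof.
  intros [_ [w [Hw [Hw0 [HwD Hwe]]]]] Hz.
  exists (w z); split; [|apply Hwe; now apply in_D_iff].
  apply schwarz; auto.
  - now apply analytic_on_D_iff.
  - intros u Hu. apply in_D_iff, HwD. now apply in_D_iff.
Qed.

(** The sign [e] selects the cusp 5/3 or 1/3. A larger radius would include the point e rho, where
    the extremal function takes the cusp value. [G] must be given explicitly since the extremal
    function is built from its primitive. *)
Lemma is_Ne_radius_Sstar (phi G : C -> C) (rho e : R) :
  0 < rho < 1 -> holo_disk G ->
  (forall z, Cmod z < 1 -> phi z = (RtoC 1 + z * G z)%C) ->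
  (forall z, Cmod z < rho -> Cmod (z * G z) < 2 / 3) ->
  e = 1 \/ e = -1 -> phi (RtoC (e * rho)) = RtoC (1 + e * (2 / 3)) ->
  is_Ne_radius (Sstar phi) rho.
Proof.
  intros Hrho HG Hphi Hin He Hcusp. split; [split; [lra|]|].
  - intros f Hf z Hz. unfold in_disk in Hz. rewrite Cnorm_E in Hz.
    destruct (Sstar_Qf_subordinate phi f z Hf) as [u [Hu ->]]; [lra|].
    rewrite Hphi by lra. apply in_OmegaNe_disk, Hin. lra.
  - intros rho' [_ Hrho']. apply Rnot_lt_le; intros Hlt.
    destruct (Sstar_extremal phi G HG Hphi) as [f [Hf HQ]].
    assert (Hm : Cmod (RtoC (e * rho)) = rho).
    { rewrite Cmod_R. destruct He as [-> | ->]; unfold Rabs; destruct Rcase_abs; lra. }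
    apply (not_in_OmegaNe_cusp e He). rewrite <- Hcusp, <- HQ by lra.
    apply (Hrho' f Hf). unfold in_disk. rewrite Cnorm_E. lra.
Qed.

(** * The classes of the quadratic and of the rational function *)

(** With r = |z|, the bound r (4/3 + 2r/3) < 2/3 means r^2 + 2r - 1 < 0, whose positive root is sqrt
    2 - 1. *)
Lemma SstarC_radius : is_Ne_radius SstarC (sqrt 2 - 1).
Proof.
  assert (Hx : sqrt 2 * sqrt 2 = 2) by (apply sqrt_sqrt; lra).
  assert (Hx0 := sqrt_pos 2).
  set (x := sqrt 2) in *.
  assert (Hb : 7 / 5 < x < 3 / 2) by (split; nra).
  assert (Hphi : forall z, phiC z = (RtoC 1 + z * (RtoC (4 / 3) + RtoC (2 / 3) * z))%C).
  { intros z. unfold phiC.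
    change (RtoC 1 + RtoC (4 / 3) * z + RtoC (2 / 3) * (z * z) =
      RtoC 1 + z * (RtoC (4 / 3) + RtoC (2 / 3) * z))%C. ring. }
  apply (is_Ne_radius_Sstar phiC (fun z => RtoC (4 / 3) + RtoC (2 / 3) * z)%C _ 1); auto.
  - lra.
  - intros z _; eexists. apply cderiv_plus; [apply cderiv_const|apply cderiv_scal, cderiv_id].
  - intros z Hz. rewrite Cmod_mult.
    assert (T := Cmod_triangle (RtoC (4 / 3)) (RtoC (2 / 3) * z)).
    rewrite Cmod_mult, !Cmod_R, !Rabs_pos_eq in T by lra.
    assert (H0 := Cmod_ge_0 z).
    apply Rle_lt_trans with (Cmod z * (4 / 3 + 2 / 3 * Cmod z)); [apply Rmult_le_compat_l; auto|].
    nra.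
  - rewrite Hphi. apply C_eq; unfold Re, Im; simpl; nra.
Qed.

(** Since (sqrt 2 - 1)(sqrt 2 + 1) = 1, the radius is k/3. With r = |z|, |phi - 1| <= r (k + r) / (k
    (k - r)), which increases with r and equals 2/3 at r = k/3. *)
Lemma SstarR_radius : is_Ne_radius SstarR (1 / (3 * sqrt 2 - 3)).
Proof.
  assert (Hx : sqrt 2 * sqrt 2 = 2) by (apply sqrt_sqrt; lra).
  assert (Hx0 := sqrt_pos 2).
  unfold SstarR. replace (1 / (3 * sqrt 2 - 3)) with (kR / 3)
    by (unfold kR; field_simplify_eq; nra).
  assert (Hk : 2 < kR < 5 / 2) by (unfold kR; nra).
  assert (Hk0 : RtoC kR <> RtoC 0) by (apply RtoC_neq_0; lra).
  assert (Hden : forall z, Cmod z < 1 -> (RtoC kR - z)%C <> RtoC 0).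
  { intros z Hz. apply Cmod_gt_0.
    generalize (Cmod_triangle_rev (RtoC kR) z). rewrite Cmod_R, Rabs_pos_eq; lra. }
  assert (Hphi : forall z, Cmod z < 1 -> phi0 z = (RtoC 1 + z * ((RtoC kR + z) * / (RtoC kR * (RtoC kR + - z))))%C).
  { intros z Hz. unfold phi0. rewrite !Defs_Cdiv_E.
    change (RtoC 1 + z / RtoC kR * ((RtoC kR + z) / (RtoC kR - z)) =
      RtoC 1 + z * ((RtoC kR + z) * / (RtoC kR * (RtoC kR - z))))%C. field. auto. }
  apply (is_Ne_radius_Sstar phi0 (fun z => (RtoC kR + z) * / (RtoC kR * (RtoC kR + - z)))%C _ 1); auto.
  - lra.
  - intros z Hz; eexists. apply cderiv_mult.
    + apply cderiv_plus; [apply cderiv_const|apply cderiv_id].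
    + apply cderiv_inv.
      * apply cderiv_scal, cderiv_plus; [apply cderiv_const|apply cderiv_opp, cderiv_id].
      * apply Cmult_neq_0; auto. now apply Hden.
  - intros z Hz. assert (H0 := Cmod_ge_0 z).
    assert (D := Hden z ltac:(lra)).
    rewrite !Cmod_mult, Cmod_inv, Cmod_mult by (apply Cmult_neq_0; auto).
    rewrite (Cmod_R kR), Rabs_pos_eq by lra.
    assert (T1 := Cmod_triangle (RtoC kR) z). assert (T2 := Cmod_triangle_rev (RtoC kR) z).
    rewrite Cmod_R, Rabs_pos_eq in T1, T2 by lra.
    change (RtoC kR + - z)%C with (RtoC kR - z)%C.
    assert (P : 0 < kR * Cmod (RtoC kR - z)) by (apply Rmult_lt_0_compat; lra).
    apply (Rmult_lt_reg_r (kR * Cmod (RtoC kR - z))); auto.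
    field_simplify; [|lra].
    apply Rle_lt_trans with (Cmod z * (kR + Cmod z)); [apply Rmult_le_compat_l; lra|].
    apply Rlt_le_trans with (2 / 3 * kR * (kR - Cmod z)); nra.
  - rewrite Hphi by (rewrite Cmod_R, Rabs_pos_eq; lra).
    rewrite Rmult_1_l, RtoC_div by lra.
    assert (H3 : RtoC 3 <> RtoC 0) by (apply RtoC_neq_0; lra).
    transitivity (RtoC 1 + RtoC 2 / RtoC 3)%C.
    + field. repeat split; auto.
      replace (RtoC kR * RtoC 3 + - RtoC kR)%C with (RtoC (2 * kR))
       by (apply C_eq; unfold Re, Im; simpl; ring). apply RtoC_neq_0; lra.
    + rewrite <- RtoC_div, <- RtoC_plus by lra. f_equal; ring.
Qed.

(** * The lemniscate class *)

Definition csqrt (z : C) : C := Csqrt z.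

(** The product of the two real roots is |y|/2, and the sign in [Csqrt] restores y. *)
Lemma csqrt_sqr (z : C) : (csqrt z * csqrt z)%C = z.
Proof.
  destruct z as [x y]. unfold csqrt, Csqrt. rewrite Cnorm_E. cbn [fst snd].
  assert (H := Cmod_sqr (x, y)). unfold Re, Im in H; cbn [fst snd] in H.
  assert (H0 := Cmod_ge_0 (x, y)). set (r := Cmod (x, y)) in *.
  assert (HA : 0 <= (r + x) / 2) by nra. assert (HB : 0 <= (r - x) / 2) by nra.
  assert (EA := sqrt_sqrt _ HA). assert (EB := sqrt_sqrt _ HB).
  assert (EAB : sqrt ((r + x) / 2) * sqrt ((r - x) / 2) = Rabs (y / 2)).
  { rewrite <- sqrt_mult, <- sqrt_Rsqr_abs by auto. f_equal. unfold Rsqr; nra. }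
  set (sA := sqrt ((r + x) / 2)) in *. set (sB := sqrt ((r - x) / 2)) in *.
  apply C_eq; unfold Re, Im; simpl.
  - destruct (Rlt_dec y 0); nra.
  - unfold Rabs in EAB. destruct (Rlt_dec y 0), (Rcase_abs (y / 2)); nra.
Qed.

Lemma csqrt_re_ge_0 (z : C) : 0 <= Re (csqrt z).
Proof.
  apply sqrt_pos.
Qed.

Lemma csqrt_re_gt_0 (z : C) : 0 < Re z -> 0 < Re (csqrt z).
Proof.
  intros H. unfold csqrt, Csqrt, Re; cbn [fst snd]. apply sqrt_lt_R0.
  rewrite Cnorm_E. generalize (Cmod_ge_0 z). unfold Re in H. lra.
Qed.

Lemma re_gt_0_neq_0 (z : C) : 0 < Re z -> z <> RtoC 0.
Proof.
  intros H E. rewrite E in H. unfold Re in H; simpl in H; lra.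
Qed.

(** Difference of squares, already in Caratheodory's form. The denominator cannot vanish for any w,
    even across the cut, because principal roots have nonnegative real part and that of z is
    positive. The same identity gives |csqrt w - csqrt z| <= |w - z| / Re (csqrt z), hence
    continuity. *)
Lemma csqrt_sub (z w : C) : 0 < Re z ->
  csqrt w = (csqrt z + / (csqrt w + csqrt z) * (w - z))%C.
Proof.
  intros Hz.
  assert (Hs : (csqrt w + csqrt z)%C <> RtoC 0).
  { apply re_gt_0_neq_0.
    exact (Rplus_le_lt_0_compat _ _ (csqrt_re_ge_0 w) (csqrt_re_gt_0 z Hz)). }
  rewrite <- (csqrt_sqr w) at 3. rewrite <- (csqrt_sqr z) at 3. field. exact Hs.
Qed.

Lemma cderiv_csqrt (z : C) : 0 < Re z -> cderiv csqrt z (/ (csqrt z + csqrt z))%C.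
Proof.
  intros Hz. assert (Hp := csqrt_re_gt_0 z Hz).
  exists (fun w => / (csqrt w + csqrt z))%C. repeat split; [|intros w; now apply csqrt_sub].
  apply (ccont_comp Cinv (fun w => csqrt w + csqrt z)%C).
  { apply ccont_inv, re_gt_0_neq_0. exact (Rplus_lt_0_compat _ _ Hp Hp). }
  apply ccont_plus; [|apply ccont_const].
  intros eps Heps. exists (eps * Re (csqrt z)); split; [now apply Rmult_lt_0_compat|].
  intros w Hw.
  assert (Hs : Re (csqrt z) <= Cmod (csqrt w + csqrt z)).
  { eapply Rle_trans; [|apply re_le_Cmod]. eapply Rle_trans; [|apply Rle_abs].
    generalize (csqrt_re_ge_0 w). unfold Re; simpl; lra. }
  replace (csqrt w - csqrt z)%C with (/ (csqrt w + csqrt z) * (w - z))%C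
    by (rewrite (csqrt_sub z w Hz) at 2; ring).
  rewrite Cmod_mult, Cmod_inv by (apply Cmod_gt_0; lra).
  rewrite Rmult_comm. apply Rlt_div_l; [lra|]. nra.
Qed.

Lemma csqrt_pos (a : R) : 0 < a -> csqrt (RtoC (a * a)) = RtoC a.
Proof.
  intros Ha. set (s := csqrt (RtoC (a * a))).
  assert (H : ((s - RtoC a) * (s + RtoC a))%C = RtoC 0).
  { transitivity (s * s - RtoC (a * a))%C; [rewrite RtoC_mult; ring|].
    unfold s; rewrite csqrt_sqr; ring. }
  apply Cmult_integral in H; destruct H as [H|H]; [now apply Cminus_eq_0|].
  exfalso; revert H. apply re_gt_0_neq_0.
  generalize (csqrt_re_ge_0 (RtoC (a * a))). fold s. unfold Re; simpl; lra.
Qed.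

(** Up to the positive factor 1/|1 + bz|^2 the real part is 1 + (b - 1) x - b |z|^2, which exceeds
    (1 - x)(1 - b) > 0. The argument of the root thus avoids the branch cut. *)
Lemma moebius_re_gt_0 (b : R) (z : C) : 0 < b < 1 -> Cmod z < 1 ->
  0 < Re ((RtoC 1 + - z) * / (RtoC 1 + RtoC b * z))%C.
Proof.
  intros Hb Hz. apply Cmod_lt_sqr in Hz; [|lra].
  destruct z as [x y]. unfold Re, Im in *; simpl in *.
  assert (Hx : -1 < x < 1) by nra.
  assert (Hden : 0 < (1 + (b * x - 0 * y)) * ((1 + (b * x - 0 * y)) * 1) +
     (0 + (b * y + 0 * x)) * ((0 + (b * y + 0 * x)) * 1)).
  { assert (0 < 1 + b * x) by nra. nra. }
  match type of Hden with 0 < ?d => set (den := d) in * end.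
  replace ((1 + - x) * ((1 + (b * x - 0 * y)) / den) - (0 + - y) * (- (0 + (b * y + 0 * x)) / den))
    with ((1 + (b - 1) * x - b * (x * x + y * y)) / den) by (field; lra).
  apply Rdiv_lt_0_compat; auto. nra.
Qed.

Section RL.

Let x := sqrt 2.
Let b := 2 * (x - 1).
(** The radius 56 / (122 - 41 sqrt 2) with rational denominator; it solves (1 + rho) / (1 - b rho) =
    s0^2. *)
Let rho := (488 + 164 * x) / 823.
(** The value s of the root at which sqrt 2 - (sqrt 2 - 1) s is the cusp value 1/3. *)
Let s0 := (5 + 2 * x) / 3.

Lemma sqrt2_bounds : x * x = 2 /\ 14142 / 10000 < x < 14143 / 10000.
Proof.
  assert (H : x * x = 2) by (apply sqrt_sqrt; lra).
  assert (H0 : 0 <= x) by apply sqrt_pos.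
  split; auto; split; nra.
Qed.

(* With [s = sqrt q] and [t = |q|], the bound [|1 - s| >= s0 - 1] turns the disk condition [|1 - q| < rho |1 + b q|] into a quadratic inequality in [t] which fails below its root [s0^2]. *)
Lemma sqrt_disk_image (s : C) :
  0 <= Re s ->
  (Cmod (RtoC 1 - s * s) < rho * Cmod (RtoC 1 + RtoC b * (s * s)))%C ->
  Cmod (RtoC 1 - s) < s0 - 1.
Proof.
  destruct sqrt2_bounds as [Hx Hxb].
  intros Ha Hq.
  assert (Hsq : Cmod (RtoC 1 - s * s) * Cmod (RtoC 1 - s * s) <
    (rho * rho) * (Cmod (RtoC 1 + RtoC b * (s * s)) * Cmod (RtoC 1 + RtoC b * (s * s)))).
  { generalize (Cmod_ge_0 (RtoC 1 - s * s)); nra. }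
  rewrite !Cmod_sqr in Hsq.
  apply Cmod_lt_sqr; [unfold s0; lra|].
  destruct s as [u v]. unfold Re, Im in *; simpl in *.
  set (t := u * u + v * v).
  (* For q = s^2 one has Re q = 2u^2 - t, so |1 - q|^2 = (1 + t)^2 - 4u^2 and |1 + bq|^2 = (1 -
     bt)^2 + 4b u^2. *)
  assert (Hmain : (1 + t) * (1 + t) - rho * rho * ((1 - b * t) * (1 - b * t)) < 4 * (u * u) * (1 + b * (rho * rho))).
  { unfold t; lra. }
  clear Hsq Hq.
  assert (R2 : rho * rho = (291936 + 160064 * x) / 677329) by (unfold rho; lra).
  assert (BR : b * (rho * rho) = (56384 + 263744 * x) / 677329) by (rewrite R2; unfold b; lra).
  assert (BBR : b * (b * (rho * rho)) = (942208 - 414720 * x) / 677329)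
    by (rewrite BR; unfold b; lra).
  assert (BR1 : b * rho = (648 * x - 320) / 823) by (unfold b, rho; lra).
  set (D := (s0 - 1) * (s0 - 1)).
  assert (ED : D = 4 / 3 + 8 / 9 * x) by (unfold D, s0; lra).
  assert (Es : s0 * s0 = 11 / 3 + 20 / 9 * x) by (unfold s0; lra).
  assert (Hrho : 0 < rho) by (unfold rho; lra).
  assert (Hb : 0 < b) by (unfold b; lra).
  (* Replacing u^2 by its bound t turns the hypothesis into (t - 1)^2 < rho^2 (1 + bt)^2, hence t <
     (1 + rho) / (1 - b rho) = s0^2. *)
  assert (Ht : t < s0 * s0).
  { assert (Hut : u * u <= t) by (unfold t; nra).
    assert (H1 : (t - 1) * (t - 1) < (rho * (1 + b * t)) * (rho * (1 + b * t))).
    { assert (4 * (u * u) * (1 + b * (rho * rho)) <= 4 * t * (1 + b * (rho * rho))).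
      { apply Rmult_le_compat_r; [rewrite BR; lra|lra]. }
      lra. }
    assert (Ht0 : 0 <= t) by (unfold t; nra).
    assert (H2 : 0 <= rho * (1 + b * t)) by (apply Rmult_le_pos; [lra|nra]).
    assert (H3 : t - 1 < rho * (1 + b * t)) by nra.
    replace (rho * (1 + b * t)) with (rho + (b * rho) * t) in H3 by ring.
    rewrite BR1 in H3.
    assert (E : s0 * s0 * (1 - (648 * x - 320) / 823) = 1 + rho)
      by (rewrite Es; unfold rho; lra).
    apply (Rmult_lt_reg_r (1 - (648 * x - 320) / 823)); [lra|]. rewrite E. lra. }
  fold D.
  replace ((1 + - u) * (1 + - u) + (0 + - v) * (0 + - v)) with (t + 1 - 2 * u)
    by (unfold t; ring).
  apply Rnot_le_lt; intros Hno.
  assert (Hu2 : 4 * (u * u) <= (t + 1 - D) * (t + 1 - D)) by nra.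
  assert (Hneg : (1 + t) * (1 + t) - rho * rho * ((1 - b * t) * (1 - b * t))
     - (1 + b * (rho * rho)) * ((t + 1 - D) * (t + 1 - D)) < 0).
  { assert (4 * (u * u) * (1 + b * (rho * rho)) <= (t + 1 - D) * (t + 1 - D) * (1 + b * (rho * rho))).
    { apply Rmult_le_compat_r; [rewrite BR; lra|lra]. }
    lra. }
  (* The quadratic in t vanishes at t = s0^2, because s = s0 gives equality in both conditions. The
     linear cofactor is al t + ga, with al = b (1 + b) rho^2. *)
  set (al := (998592 - 150976 * x) / 677329).
  set (ga := 865576 / 6095961 - 1026544 / 2031987 * x).
  assert (Hfac : (1 + t) * (1 + t) - rho * rho * ((1 - b * t) * (1 - b * t))
     - (1 + b * (rho * rho)) * ((t + 1 - D) * (t + 1 - D)) = (s0 * s0 - t) * (al * t + ga)).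
  { replace (rho * rho * ((1 - b * t) * (1 - b * t))) with
      (rho * rho - 2 * (b * (rho * rho)) * t + b * (b * (rho * rho)) * (t * t)) by ring.
    rewrite BBR, BR, R2, ED, Es. unfold al, ga.
    assert (M1 : x * x * t = 2 * t) by (rewrite Hx; ring).
    assert (M2 : x * x * (t * t) = 2 * (t * t)) by (rewrite Hx; ring).
    assert (M3 : x * x * x = 2 * x) by (rewrite Hx; ring).
    assert (M4 : x * x * x * t = 2 * x * t) by (rewrite Hx; ring).
    lra. }
  assert (0 < al * t + ga).
  (* The assumption 2u <= t + 1 - D with u >= 0 bounds t from below, and the cofactor is already
     positive at that bound. *)
  { assert (Htl : D - 1 <= t) by lra. rewrite ED in Htl.
    assert (0 < al) by (unfold al; lra).
    assert (al * (8 / 9 * x + 1 / 3) <= al * t) by (apply Rmult_le_compat_l; lra).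
    assert (0 < al * (8 / 9 * x + 1 / 3) + ga) by (unfold al, ga; lra). lra. }
  assert (0 < (s0 * s0 - t) * (al * t + ga)) by (apply Rmult_lt_0_compat; lra).
  lra.
Qed.

Lemma SstarRL_radius : is_Ne_radius SstarRL (56 / (122 - 41 * sqrt 2)).
Proof.
  fold x. destruct sqrt2_bounds as [Hx Hxb].
  replace (56 / (122 - 41 * x)) with rho by (unfold rho; field_simplify_eq; lra).
  assert (Hrho : 0 < rho < 1) by (unfold rho; lra).
  assert (Hb : 0 < b < 1) by (unfold b; lra).
  set (q := fun z => ((RtoC 1 + - z) * / (RtoC 1 + RtoC b * z))%C).
  assert (Hden : forall z, Cmod z < 1 -> (RtoC 1 + RtoC b * z)%C <> RtoC 0).
  { intros z Hz E. assert (H := moebius_re_gt_0 b z Hb Hz).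
    rewrite E in H. unfold Re in H; simpl in H.
    unfold Rdiv in H. lra. }
  assert (Hq : forall z, Cmod z < 1 -> 0 < Re (q z)) by (intros; now apply moebius_re_gt_0).
  assert (Hs : forall z, (RtoC 1 + csqrt (q z))%C <> RtoC 0).
  { intros z; apply re_gt_0_neq_0. generalize (csqrt_re_ge_0 (q z)).
    unfold Re; simpl; lra. }
  assert (HphiE : forall z, phiRL z = (RtoC x - RtoC (x - 1) * csqrt (q z))%C).
  { intros z. unfold phiRL. rewrite Defs_Cdiv_E. reflexivity. }
  assert (Hlin : forall z, Cmod z < 1 -> (RtoC 1 - q z = RtoC (1 + b) * z * / (RtoC 1 + RtoC b * z))%C).
  { intros z Hz. unfold q. rewrite RtoC_plus. field. auto. }
  (* phi - 1 = (sqrt 2 - 1)(1 - sqrt q), where 1 - sqrt q = (1 - q) / (1 + sqrt q) and 1 - q = (1 +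
     b) z / (1 + bz): the factor z comes out explicitly. *)
  set (G := fun z => (RtoC ((x - 1) * (1 + b)) * / ((RtoC 1 + RtoC b * z) * (RtoC 1 + csqrt (q z))))%C).
  assert (HG : forall z, Cmod z < 1 -> (z * G z)%C = (RtoC (x - 1) * (RtoC 1 - csqrt (q z)))%C).
  { intros z Hz. unfold G. rewrite RtoC_mult.
    transitivity (RtoC (x - 1) * ((RtoC 1 - q z) * / (RtoC 1 + csqrt (q z))))%C.
    - rewrite Hlin by auto. field. auto.
    - rewrite <- (csqrt_sqr (q z)) at 1. field. auto. }
  apply (is_Ne_radius_Sstar phiRL G rho (-1)); auto.
  - intros z Hz. unfold G. eexists. apply cderiv_scal, cderiv_inv.
    + apply cderiv_mult.
      * apply cderiv_plus; [apply cderiv_const|apply cderiv_scal, cderiv_id].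
      * apply cderiv_plus; [apply cderiv_const|].
        apply (cderiv_comp csqrt q); [now apply cderiv_csqrt, Hq|].
        apply cderiv_mult; [apply cderiv_plus; [apply cderiv_const|apply cderiv_opp, cderiv_id]|].
        apply cderiv_inv; [|now apply Hden].
        apply cderiv_plus; [apply cderiv_const|apply cderiv_scal, cderiv_id].
    + apply Cmult_neq_0; auto.
  - intros z Hz. rewrite HG, HphiE by auto.
    rewrite RtoC_minus. ring.
  - intros z Hz. rewrite HG by lra. rewrite Cmod_mult, Cmod_R, Rabs_pos_eq by lra.
    assert (Hd := Hden z ltac:(lra)).
    (* It inverts the Moebius map: 1 - q = z (1 + bq), so |z| < rho becomes the disk condition of
       [sqrt_disk_image]. *)
    assert (Hprod : ((RtoC 1 + RtoC b * q z) * (RtoC 1 + RtoC b * z))%C = RtoC (1 + b)).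
    { unfold q. rewrite RtoC_plus. field. auto. }
    assert (Hne : (RtoC 1 + RtoC b * q z)%C <> RtoC 0).
    { intros E. rewrite E in Hprod. apply (RtoC_neq_0 (1 + b)); [lra|].
      rewrite <- Hprod. ring. }
    apply Cmod_gt_0 in Hne.
    assert (Hlt : Cmod (RtoC 1 - csqrt (q z)) < s0 - 1).
    { apply sqrt_disk_image; [apply csqrt_re_ge_0|]. rewrite csqrt_sqr.
      replace (RtoC 1 - q z)%C with (z * (RtoC 1 + RtoC b * q z))%C.
      - rewrite Cmod_mult. apply Rmult_lt_compat_r; auto.
      - rewrite Hlin by lra. rewrite <- Hprod. field. auto. }
    apply Rlt_le_trans with ((x - 1) * (s0 - 1)); [apply Rmult_lt_compat_l; lra|].
    (* (sqrt 2 - 1)(s0 - 1) = 2/3, as s0 - 1 = 2 (sqrt 2 + 1) / 3. *)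
    unfold s0; lra.
  - rewrite HphiE.
    assert (Eq : q (RtoC (-1 * rho)) = RtoC (s0 * s0)).
    { assert (Hd : 1 - b * rho <> 0) by (unfold b, rho; lra).
      transitivity (RtoC (1 + rho) * / RtoC (1 - b * rho))%C.
      - unfold q. f_equal; [|f_equal]; apply C_eq; unfold Re, Im; simpl; ring.
      - rewrite <- RtoC_inv, <- RtoC_mult by auto. f_equal.
        apply (Rmult_eq_reg_r (1 - b * rho)); auto. field_simplify; auto.
        unfold s0, b, rho.
        assert (M3 : x * x * x = 2 * x) by (rewrite Hx; ring).
        assert (M4 : x * x * x * x = 4) by (rewrite M3; lra). lra. }
    rewrite Eq, csqrt_pos by (unfold s0; lra).
    apply C_eq; unfold Re, Im; simpl; [unfold s0; lra|ring].
Qed.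

End RL.

Theorem mainTheorem7 :
  is_Ne_radius SstarRL (56 / (122 - 41 * sqrt 2)) /\
  is_Ne_radius SstarC (sqrt 2 - 1) /\
  is_Ne_radius SstarR (1 / (3 * sqrt 2 - 3)).
Proof.
  split; [|split].
  - apply SstarRL_radius.
  - apply SstarC_radius.
  - apply SstarR_radius.
Qed.
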